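(* Under the Bayesian FH-SC model (defined in the context), for $c=1,\dots,C$ and $j=1,\dots,n_c$, let $\hat\theta_{j,c}$ be the Rao–Blackwell estimator and $\hat\theta^{B}_{j,c}$ the Rao–Blackwell benchmarked estimator of area $j$ in cluster $c$ (defined in the context). The Conditional Posterior Mean Square Error (CPMSE) of $\hat\theta^{B}_{j,c}$ is given by $$\mathrm{CPMSE}(\hat\theta^{B}_{j,c}\mid X_c,Z_c,y_c)=E_{\vartheta_{-\theta_{j,c}}}\left(E_{\theta^{FHSC}_{j,c}}\left((\hat\theta^{B}_{j,c}-\theta^{FHSC}_{j,c})^{2}\mid X_c,Z_c,y_c,\vartheta_{-\theta_{j,c}}\right)\right)$$ $$=\left(\hat\theta^{B}_{j,c}-\hat\theta_{j,c}\right)^{2}+\mathrm{CPMSE}(\hat\theta_{j,c}\mid X_c,Z_c,y_c)$$ $$\approx\left(\hat\theta^{B}_{j,c}-\hat\theta_{j,c}\right)^{2}+\frac1{L-T}\sum_{l=T+1}^{L}V(\theta^{FHSC(l)}_{j,c}\mid X_c,Z_c,y_c,\vartheta^{(l)}_{-\theta_{j,c}})+\frac1{L-T}\sum_{l=T+1}^{L}\left(E(\theta^{FHSC(l)}_{j,c}\mid X_c,Z_c,y_c,\vartheta^{(l)}_{-\theta_{j,c}})-\hat\theta_{j,c}\right)^{2},$$ where the conditional expectation $E(\theta^{FHSC(l)}_{j,c}\mid\cdot)$ and conditional variance $V(\theta^{FHSC(l)}_{j,c}\mid\cdot)$ are those given by the closed-form expressions recalled in the context, evaluated at the $l$-th MCMC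 draw $\vartheta^{(l)}=(\delta^{(l-1)},G_{\varphi^{(l-1)}},\rho^{(l)})$, and $L$ and $T$ are the total number and the number of discarded MCMC samples, respectively.
   Context: $\mathbb I_k$ is the $k\times k$ identity, $\mathbf 1_k$ the column vector of $k$ ones. FH-SC model: for clusters $c=1,\dots,C$ with $n_c$ areas ($m$ areas in total), $y_c=\theta_c^{FHSC}+e_c$, $\theta_c^{FHSC}=A_{\rho,c}^{-1}\theta_c$, $\theta_c=X_c\delta_c+Z_cu_c$, with $e_c\sim N(0,D_c)$ and $u_c\sim N(0,G_{\varphi,c})$ independent, $D_c=\mathrm{diag}(D_{1,c},\dots,D_{n_c,c})$ the direct variances, $X_c,Z_c$ known design matrices, $\rho\in(0,1]$, $A_{\rho,c}=\mathbb I_{n_c}+\frac{1-\rho}{\rho}(n_c\mathbb I_{n_c}-\mathbf 1_{n_c}\mathbf 1_{n_c}^{\top})$, together with a joint prior built from priors on the variance parameters $\varphi$ in $G_{\varphi,c}$, on $\delta_c$ and on $\rho$. Put $A_\rho=\mathrm{blkdiag}(A_{\rho,1},\dots,A_{\rho,C})$; $\theta^{FHSC},X,Z,y,\delta,G_\varphi$ collect the cluster quantities. $\vartheta_{-\theta_{j,c}}$ is the set of parameters of the model excluding $\theta_{j,c}$ (and $\vartheta_{-\theta}$ excludes the whole vector $\theta$); $E_{\vartheta}$ denotes posterior expectation over these parameters. For any estimator $t$ of $\theta^{FHSC}_{j,c}$, $\mathrm{CPMSE}(t\mid X_c,Z_c,y_c)=E_{\vartheta_{-\theta_{j,c}}}\big(E_{\theta^{FHSC}_{j,c}}((t-\theta^{FHSC}_{j,c})^2\mid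 X_c,Z_c,y_c,\vartheta_{-\theta_{j,c}})\big)$. MCMC: draws $l=1,\dots,L$ from the posterior, the first $T$ discarded. Rao–Blackwell estimator: $\hat\theta=E_{\vartheta_{-\theta}}(E(\theta^{FHSC}\mid X,Z,y,\vartheta_{-\theta}))\approx\frac1{L-T}\sum_{l=T+1}^{L}E(\theta^{FHSC(l)}\mid X,Z,y,\vartheta^{(l)})$, with components $\hat\theta_{j,c}$. Rao–Blackwell benchmarked estimator: for constraints $W\theta=p$, with $W\in\mathbb R^{k\times m}$ of full row rank $k\le m$ and $p\in\mathbb R^k$, put $\theta^{B(l)}=\theta^{FHSC(l)}+A_{\rho^{(l)}}^{-1}W^{\top}(WA_{\rho^{(l)}}^{-1}W^{\top})^{-1}(p-W\theta^{FHSC(l)})$ (and $\theta^B$ likewise without the index $l$); then $\hat\theta^{B}=E_{\vartheta_{-\theta}}(E(\theta^{B}\mid X,Z,y,\vartheta_{-\theta}))\approx\frac1{L-T}\sum_{l=T+1}^{L}E(\theta^{B(l)}\mid X,Z,y,\vartheta^{(l)})$, with components $\hat\theta^{B}_{j,c}$. Closed-form conditional moments: with ''$\mid\cdot$'' denoting conditioning on $(\delta_c,G_{\varphi,c},\rho,Z_c,X_c,y_c)$ and $\gamma_c=\rho/((1-\rho)n_c+\rho)$, $E(\theta_c^{FHSC}\mid\cdot)=\gamma_cE(\theta_c\mid\cdot)+(1-\gamma_c)\big(\frac1{n_c}\sum_jE(\theta_{j,c}\mid\cdot)\big)\mathbf 1_{n_c}$, $V(\theta_c^{FHSC}\mid\cdot)=\gamma_cV(\theta_c\mid\cdot)+(1-\gamma_c)(1+\gamma_c)\sum_jV(\theta_{j,c}\mid\cdot)/n_c$,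 with $E(\theta_c\mid\cdot)=V(\theta_c\mid\cdot)\big(D_c^{-1}A_{\rho,c}^{-1}y_c+(Z_cG_{\varphi,c}Z_c^{\top})^{-1}X_c\delta_c\big)$ and $V(\theta_c\mid\cdot)=\big((A_{\rho,c}D_cA_{\rho,c}^{\top})^{-1}+(Z_cG_{\varphi,c}Z_c^{\top})^{-1}\big)^{-1}$; $E(\theta^{FHSC}_{j,c}\mid\cdot)$ and $V(\theta^{FHSC}_{j,c}\mid\cdot)$ are the corresponding quantities for area $j$.
   Formalization: The printed closed forms are wrong (n_c=1 gives variance (1+ρ−ρ²)V, not V); the formal version uses the true variance of area j, entry (j,j) of A^{-1}VA^{-T}, and A^{-1}D^{-1}y for D^{-1}A^{-1}y in the mean; ≈ is read as a.s. convergence as L→∞ for ergodic draws. *)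

(* Defs.v *)
From HB Require Import structures.
From mathcomp Require Import all_boot all_order all_algebra.
From mathcomp Require Import all_classical all_reals all_analysis.

Set Implicit Arguments.
Unset Strict Implicit.
Unset Printing Implicit Defensive.

Import Order.TTheory GRing.Theory Num.Theory.
Import numFieldNormedType.Exports.

Local Open Scope classical_set_scope.
Local Open Scope ring_scope.

Section GaussianLaw.
Context {R : realType}.

(* Measurable vectors are tuples (matrices carry no sigma-algebra in the
   library); these maps go to and from column vectors. *)
Definition col_of_tuple n (t : n.-tuple R) : 'cV[R]_n := \col_i tnth t i.
Definition tuple_of_col n (v : 'cV[R]_n) : n.-tuple R :=
  [tuple v i ord0 | i < n].

(* n independent N(0,1) coordinates.  Boxes generate the sigma-algebra of
   [n.-tuple R], so this determines [N]. *)
Definition std_gaussian n (N : probability (n.-tuple R) R) : Prop :=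
  forall B : 'I_n -> set R, (forall i, measurable (B i)) ->
    N [set z | forall i, B i (tnth z i)] =
    (\prod_(i < n) normal_prob (0 : R) 1 (B i))%E.

(* [Q] is N(mu, Sigma), possibly degenerate: the law of mu + S z with z standard
   Gaussian and S S^T = Sigma. *)
Definition gaussian_law n (mu : 'cV[R]_n) (Sigma : 'M[R]_n)
    (Q : set (n.-tuple R) -> \bar R) : Prop :=
  exists (N : probability (n.-tuple R) R) (S : 'M[R]_n),
    [/\ std_gaussian N, S *m S^T = Sigma &
        forall B : set (n.-tuple R), measurable B ->
          Q B = N [set z | B (tuple_of_col (mu + S *m col_of_tuple z))]].

End GaussianLaw.

(* Known quantities.  [n c], [p c], [q c] are the numbers of areas, of covariates
   (length of delta_c) and of random effects (length of u_c) in cluster c. *)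
Record fhsc_data (R : realType) (C : nat) (n p q : 'I_C -> nat) := FHSCData {
  design_X : forall c, 'M[R]_(n c, p c);
  design_Z : forall c, 'M[R]_(n c, q c);
  direct_var : forall c, 'rV[R]_(n c);
  obs : forall c, 'cV[R]_(n c)
}.

Section FHSC.
Context {R : realType} {C : nat} {n p q : 'I_C -> nat}.
Context {d : measure_display} {Phi : measurableType d}.

Local Notation m := (\sum_(c < C) n c)%N.
Local Notation np := (\sum_(c < C) p c)%N.
Local Notation nq := (\sum_(c < C) q c)%N.

(* x = (delta, phi, rho) is vartheta, the parameters other than theta; the
   coefficients delta_c are stacked in one vector. *)
Local Notation delta x := (x.1.1).
Local Notation phi x := (x.1.2).
Local Notation rho x := (x.2).

Variable M : fhsc_data R n p q.
Local Notation X := (design_X M).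
Local Notation Z := (design_Z M).
Local Notation D c := (diag_mx (direct_var M c)).
Local Notation y := (obs M).

Variable G : Phi -> forall c, 'M[R]_(q c).

(* u ~ U phi is the stacked vector of the u_c, and G_phi = blkdiag(G_{phi,c}). *)
Definition random_effects_law (U : R.-pker Phi ~> nq.-tuple R) : Prop :=
  forall f : Phi, gaussian_law 0 (\mxdiag_c G f c) (U f).

Definition A (r : R) (c : 'I_C) : 'M[R]_(n c) :=
  let one : 'cV[R]_(n c) := const_mx 1 in
  1%:M + ((1 - r) / r) *: ((n c)%:R%:M - one *m one^T).

Definition theta (x : (np.-tuple R * Phi) * R) (u : nq.-tuple R) (c : 'I_C) :
    'cV[R]_(n c) :=
  X c *m submxcol (col_of_tuple (delta x)) c
  + Z c *m submxcol (col_of_tuple u) c.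

Definition thetaF (x : (np.-tuple R * Phi) * R) (u : nq.-tuple R) (c : 'I_C) :
    'cV[R]_(n c) :=
  invmx (A (rho x) c) *m theta x u c.

(* density at the data y of y = theta^FHSC + e, e_c ~ N(0, D_c) independent
   over c; [normal_pdf] takes a standard deviation *)
Definition lik (x : (np.-tuple R * Phi) * R) (u : nq.-tuple R) : R :=
  \prod_(c < C) \prod_(j < n c)
    normal_pdf (thetaF x u c j ord0) (Num.sqrt (direct_var M c ord0 j))
               (y c j ord0).

Variable U : R.-pker Phi ~> nq.-tuple R.
Variable prior : probability ((np.-tuple R * Phi) * R)%type R.

(* The joint posterior of (vartheta, u) is prior(d vartheta) U_phi(du) lik,
   normalised (Bayes).  It is used through its disintegration: the conditional
   law given vartheta, and the marginal posterior of vartheta. *)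
Definition marg_lik (x : (np.-tuple R * Phi) * R) : R :=
  \int[U (phi x)]_u lik x u.

Definition cond_exp (x : (np.-tuple R * Phi) * R) (f : nq.-tuple R -> R) : R :=
  (\int[U (phi x)]_u (f u * lik x u)) / marg_lik x.

Definition cond_var (x : (np.-tuple R * Phi) * R) (f : nq.-tuple R -> R) : R :=
  cond_exp x (fun u => (f u - cond_exp x f) ^+ 2).

Definition evidence : R := \int[prior]_x marg_lik x.

Definition post_exp (h : (np.-tuple R * Phi) * R -> R) : R :=
  (\int[prior]_x (h x * marg_lik x)) / evidence.

Definition post_integrable (h : (np.-tuple R * Phi) * R -> R) : Prop :=
  prior.-integrable setT (fun x => (h x * marg_lik x)%:E).

(* The data being fixed, an estimator is a real number t.  No integrability is
   needed for the integrals of thetaF below not to be the default value of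
   [Rintegral]: for 0 < rho <= 1, thetaF ^+ 2 * lik is bounded. *)
Definition CPMSE (t : R) (c : 'I_C) (j : 'I_(n c)) : R :=
  post_exp (fun x => cond_exp x (fun u => (t - thetaF x u c j ord0) ^+ 2)).

Definition theta_hat (c : 'I_C) (j : 'I_(n c)) : R :=
  post_exp (fun x => cond_exp x (fun u => thetaF x u c j ord0)).

Section Benchmark.
Variables (k : nat) (W : 'M[R]_(k, m)) (b : 'cV[R]_k).

Definition thetaB (x : (np.-tuple R * Phi) * R) (u : nq.-tuple R) : 'cV[R]_m :=
  let v : 'cV[R]_m := \mxcol_c thetaF x u c in
  let Ai : 'M[R]_m := invmx (\mxdiag_c A (rho x) c) in
  v + Ai *m W^T *m invmx (W *m Ai *m W^T) *m (b - W *m v).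

Definition thetaB_hat (c : 'I_C) (j : 'I_(n c)) : R :=
  post_exp (fun x => cond_exp x (fun u => submxcol (thetaB x u) c j ord0)).

End Benchmark.

(* Closed forms of the conditional moments given vartheta. *)

Definition gam (r : R) (c : 'I_C) : R := r / ((1 - r) * (n c)%:R + r).

Definition ZGZ (x : (np.-tuple R * Phi) * R) (c : 'I_C) : 'M[R]_(n c) :=
  Z c *m G (phi x) c *m (Z c)^T.

Definition cf_V (x : (np.-tuple R * Phi) * R) (c : 'I_C) : 'M[R]_(n c) :=
  invmx (invmx (A (rho x) c *m D c *m (A (rho x) c)^T) + invmx (ZGZ x c)).

(* A^-1 stands to the left of D^-1 (A is symmetric): the linear term of the
   Gaussian log-likelihood of theta_c is theta_c^T A^-T D^-1 y_c, and the two
   factors commute only if D_c is a multiple of the identity. *)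
Definition cf_E (x : (np.-tuple R * Phi) * R) (c : 'I_C) : 'cV[R]_(n c) :=
  cf_V x c *m (invmx (A (rho x) c) *m invmx (D c) *m y c
               + invmx (ZGZ x c) *m (X c *m submxcol (col_of_tuple (delta x)) c)).

Definition cf_EF (x : (np.-tuple R * Phi) * R) (c : 'I_C) (j : 'I_(n c)) : R :=
  let g := gam (rho x) c in
  g * cf_E x c j ord0 + (1 - g) * ((n c)%:R^-1 * \sum_(i < n c) cf_E x c i ord0).

(* (j, j) entry of A^-1 V A^-T, where A^-1 = g I + (1 - g) / n_c * 1 1^T. *)
Definition cf_VF (x : (np.-tuple R * Phi) * R) (c : 'I_C) (j : 'I_(n c)) : R :=
  let g := gam (rho x) c in
  let V := cf_V x c in
  g ^+ 2 * V j j
  + 2 * g * (1 - g) / (n c)%:R * (\sum_(i < n c) V j i)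
  + (1 - g) ^+ 2 / (n c)%:R ^+ 2 * (\sum_(i < n c) \sum_(i' < n c) V i i').

Section MCMC.
Context {dS : measure_display} {S : measurableType dS}.
Variable (P : probability S R).
Variables (delta_ : nat -> {mfun S >-> np.-tuple R}) (phi_ : nat -> {mfun S >-> Phi})
          (rho_ : nat -> {mfun S >-> R}).

(* vartheta^(l) = (delta^(l-1), phi^(l-1), rho^(l)), l >= 1. *)
Definition draw (l : nat) (s : S) : (np.-tuple R * Phi) * R :=
  ((delta_ l.-1 s, phi_ l.-1 s), rho_ l s).

(* The draws come from the posterior in the sense of the ergodic theorem. *)
Definition mcmc_ergodic : Prop :=
  forall h : (np.-tuple R * Phi) * R -> R,
    measurable_fun setT h -> post_integrable h ->
    {ae P, forall s, (fun L : nat => L%:R^-1 * \sum_(1 <= l < L.+1) h (draw l s))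
                       @ \oo --> post_exp h}.

End MCMC.

End FHSC.

(* Main.v *)
(** Write theta^FHSC = a + H z with z standard Gaussian: given vartheta, the
    likelihood of y is a product of Gaussian densities in the coordinates of
    theta^FHSC.  Integration by parts in z (Stein's identity), applied to the
    likelihood and to theta^FHSC_j times the likelihood, gives linear equations
    for the conditional mean mu and covariance S of theta^FHSC_c, namely
    mu - a = K D^-1 (y - mu) and S + K D^-1 S = K, where K is the prior covariance
    of theta^FHSC_c; the clusters decouple because the blocks of H H^T indexed by
    distinct clusters vanish.  Solving them gives the closed forms; A_rho is a
    combination of the identity and the all-ones matrix, hence explicitly
    invertible.  The likelihood multiplied by 1 or by the square of a coordinate
    of theta^FHSC is bounded uniformly in vartheta, so every posterior integral
    converges, and the CPMSE of t is t^2 - 2 t theta_hat plus a constant, whence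
    the decomposition.  The MCMC limit is the ergodic theorem applied to
    V + (E - theta_hat)^2, which integrates to the CPMSE of theta_hat. *)

Require Import Defs.
From HB Require Import structures.
From mathcomp Require Import all_boot all_order all_algebra.
From mathcomp Require Import all_classical all_reals all_analysis.
From mathcomp Require Import measurable_realfun ring lra.

Set Implicit Arguments.
Unset Strict Implicit.
Unset Printing Implicit Defensive.

Import Order.TTheory GRing.Theory Num.Theory.
Import numFieldNormedType.Exports.

Local Open Scope classical_set_scope.
Local Open Scope ring_scope.

(** * Stein's identity in one dimension *)

Section OneDimensionalStein.
Context {R : realType}.
Local Notation mu := (@lebesgue_measure R).
Local Notation gauss := (normal_prob (0 : R) 1).
Local Notation pdf := (normal_pdf (0 : R) 1).

Lemma ge0_integral_normal_prob (f : R -> \bar R) :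
  (forall x, (0 <= f x)%E) -> measurable_fun setT f ->
  (\int[gauss]_x f x = \int[mu]_x (f x * (pdf x)%:E))%E.
Proof.
move=> f0 mf.
have dom := @normal_prob_dominates R 0 1.
rewrite -(Radon_Nikodym_SigmaFinite.change_of_variables dom)//.
apply: ae_eq_integral => //.
- apply: emeasurable_funM => //; apply: (measurable_int mu).
  exact: Radon_Nikodym_SigmaFinite.f_integrable.
- apply: emeasurable_funM => //=; apply/measurable_EFinP.
  exact: measurable_normal_pdf.
- apply: ae_eqe_mul2l => /=.
  apply: integral_ae_eq => //=.
  + exact: Radon_Nikodym_SigmaFinite.f_integrable.
  + by apply/measurable_EFinP; exact: measurable_normal_pdf.
  + by move=> E _ mE; rewrite -Radon_Nikodym_SigmaFinite.f_integral.
Qed.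

Lemma integral_normal_prob (f : R -> \bar R) : measurable_fun setT f ->
  (\int[gauss]_x f x = \int[mu]_x (f x * (pdf x)%:E))%E.
Proof.
move=> mf; rewrite integralE [RHS]integralE.
have pdf0 x : (0 <= (pdf x)%:E)%E by rewrite lee_fin normal_pdf_ge0.
rewrite !ge0_integral_normal_prob//.
- congr (_ - _)%E; apply: eq_integral => x _.
    by rewrite !funeposE maxe_pMl// mul0e.
  by rewrite !funenegE maxe_pMl// mul0e mulNe.
- exact: measurable_funeneg.
- exact: measurable_funepos.
Qed.

Lemma normal_pdf01E x : pdf x = normal_peak 1 * expR (- x ^+ 2 / 2).
Proof.
by rewrite normal_pdfE ?oner_eq0// /normal_fun subr0 expr1n.
Qed.

(* (1 + |s|) <= 2 (1 + s^2 / 4) <= 2 exp (s^2 / 4) *)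
Lemma integrable_linear_normal_pdf (f : R -> R) (c : R) :
  measurable_fun setT f -> (forall x, `|f x| <= c * (1 + `|x|)) ->
  mu.-integrable setT (fun x => (f x * pdf x)%:E).
Proof.
move=> mf fc.
have c0 : 0 <= c.
  have := fc 0; rewrite normr0 addr0 mulr1; exact: le_trans.
(* The dominating function is a multiple of the density of N(0, 2), proportional to exp (-x^2 / 4):
   half of the exponent of [pdf] absorbs the linear growth. [K] collects [c], the factor 2 in the
   bound on 1 + |x| and the ratio of the peaks. *)
pose K := c * 2 * normal_peak 1 / normal_peak (Num.sqrt (2:R)).
have s20 : Num.sqrt (2:R) != 0 by rewrite gt_eqF// sqrtr_gt0.
apply: (@le_integrable _ _ _ mu _ measurableT _
   (fun x => K%:E * (normal_pdf 0 (Num.sqrt 2) x)%:E)%E).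
- apply/measurable_EFinP; apply: measurable_funM => //.
  exact: measurable_normal_pdf.
- move=> x _; rewrite -EFinM !abse_EFin lee_fin.
  have K0 : 0 <= K by rewrite /K !mulr_ge0 ?invr_ge0 ?normal_peak_ge0.
  rewrite [leRHS](ger0_norm (mulr_ge0 K0 (normal_pdf_ge0 _ _ _))).
  rewrite normrM (ger0_norm (normal_pdf_ge0 _ _ _)).
  rewrite normal_pdf01E (normal_pdfE _ s20) /normal_fun subr0 sqr_sqrtr//.
  rewrite (mulrA K) /K divfK; last by rewrite gt_eqF// normal_peak_gt0.
  have h : 1 + `|x| <= 2 * expR (x ^+ 2 / 4).
    have : 1 + x ^+ 2 / 4 <= expR (x ^+ 2 / 4) by apply: expR_ge1Dx.
    have : `|x| <= 1 + x ^+ 2 / 4.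
      have : 0 <= (`|x| / 2 - 1) ^+ 2 by rewrite sqr_ge0.
      by rewrite -(real_normK (num_real x)); nra.
    have : 0 <= x ^+ 2 by rewrite sqr_ge0.
    lra.
  have e : expR (- x ^+ 2 / 2) = expR (- (x ^+ 2 / 4)) * expR (- (x ^+ 2 / 4)).
    by rewrite -expRD; congr expR; field.
  have e' : - x ^+ 2 / (2 *+ 2) = - (x ^+ 2 / 4) by field.
  rewrite e' e.
  have p0 := normal_peak_ge0 (1:R).
  apply: (@le_trans _ _ (c * (2 * expR (x ^+ 2 / 4)) *
      (normal_peak 1 * (expR (- (x ^+ 2 / 4)) * expR (- (x ^+ 2 / 4)))))).
    apply: ler_pM => //; first by rewrite !mulr_ge0 ?expR_ge0.
    by apply: (le_trans (fc x)); rewrite ler_wpM2l.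
  have e1 : expR (x ^+ 2 / 4) * expR (- (x ^+ 2 / 4)) = 1.
    by rewrite -expRD subrr expR0.
  rewrite le_eqVlt; apply/orP; left; apply/eqP.
  transitivity (c * 2 * normal_peak 1 * expR (- (x ^+ 2 / 4)) *
    (expR (x ^+ 2 / 4) * expR (- (x ^+ 2 / 4)))); first by ring.
  by rewrite e1 mulr1.
- exact: (integrableZl measurableT K (integrable_normal_pdf 0 (Num.sqrt 2))).
Qed.

Lemma is_derive_normal_pdf (x : R) : is_derive x (1:R) pdf (- x * pdf x).
Proof.
have -> : pdf = (fun x => normal_peak 1 * expR (- x ^+ 2 / 2)) :> (R -> R).
  by apply/funext => y; rewrite normal_pdf01E.
apply: is_derive_eq.
rewrite /GRing.scale /=.
by field.
Qed.

(** From exp (n^2 / 2) >= 1 + n^2 / 2 >= (n + 1) / 2. This crude decay is enough to make the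
    boundary terms of the integration by parts vanish. *)
Lemma normal_pdf_le_inv (n : nat) : pdf n%:R <= normal_peak 1 * 2 * (n.+1%:R)^-1.
Proof.
rewrite normal_pdf01E -mulrA ler_wpM2l ?normal_peak_ge0//.
rewrite mulNr expRN -[leRHS]invrK lef_pV2 ?posrE ?expR_gt0//.
apply: (le_trans _ (expR_ge1Dx _)).
rewrite invfM invrK -[n.+1%:R]natr1.
have : 0 <= (n%:R - 1 / 2) ^+ 2 :> R by rewrite sqr_ge0.
lra.
Qed.

Lemma normal_pdfN (x : R) : pdf (- x) = pdf x.
Proof. by rewrite !normal_pdf01E sqrrN. Qed.

(** The integrand is the derivative of -h pdf. The fundamental theorem of calculus on growing
    symmetric intervals leaves boundary terms that tend to 0, and dominated convergence passes to
    the whole line. *)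
Lemma integral_derive_normal_pdf (h h' : R -> R) (c : R) :
  (forall x, is_derive x (1:R) h (h' x)) -> continuous h' ->
  (forall x, `|h x| <= c) -> (forall x, `|h' x| <= c) ->
  (\int[mu]_x ((x * h x - h' x) * pdf x)%:E = 0)%E.
Proof.
move=> dh ch' hc h'c.
have c0 : 0 <= c by exact: le_trans (hc 0).
have ch : continuous h.
  move=> x; apply: differentiable_continuous; apply/derivable1_diffP.
  by have [] := dh x.
pose F x := - (h x * pdf x).
pose g x := (x * h x - h' x) * pdf x.
have dF x : is_derive x (1:R) F (g x).
  have d1 := dh x; have d2 := is_derive_normal_pdf x.
  apply: is_derive_eq.
  by rewrite /g /GRing.scale /=; ring.
have cg : continuous g.
  move=> x; apply: cvgM; last exact: continuous_normal_pdf (oner_neq0 _) x.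
  apply: cvgB; last exact: ch'.
  by apply: cvgM => //; exact: ch.
have mg : measurable_fun setT g by exact: continuous_measurable_fun.
have ig : mu.-integrable setT (EFin \o g).
  apply: (@integrable_linear_normal_pdf _ c).
    apply: continuous_measurable_fun => x; apply: cvgB; last exact: ch'.
    by apply: cvgM => //; exact: ch.
  move=> x; apply: (le_trans (ler_normB _ _)); rewrite normrM.
  have := ler_wpM2l (normr_ge0 x) (hc x); have := h'c x; lra.
have cF x : {for x, continuous F}.
  apply: differentiable_continuous; apply/derivable1_diffP.
  by have [] := dF x.
have FTC (n : nat) : (\int[mu]_(x in `[(- n.+1%:R)%R, n.+1%:R%R]) (g x)%:E
    = (F n.+1%:R%R)%:E - (F (- n.+1%:R)%R)%:E)%E.
  apply: continuous_FTC2.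
  - by rewrite gtrN.
  - exact: continuous_subspaceT.
  - split.
    + by move=> x _; have [] := dF x.
    + exact/cvg_at_right_filter/cF.
    + exact/cvg_at_left_filter/cF.
  - by move=> x _; rewrite derive1E; have [_ ->] := dF x.
(* The successor keeps the interval nondegenerate at n = 0, as [FTC] requires. *)
pose gn (n : nat) := (EFin \o g) \_ `[- n.+1%:R, n.+1%:R].
have mgn n : measurable_fun setT (gn n).
  apply/(measurable_restrictT _ _).1 => //.
  by apply/measurable_EFinP; exact: measurable_funTS.
have gng : {ae mu, forall x, setT x -> gn ^~ x @ \oo --> (EFin \o g) x}.
  apply: aeW => x _.
  apply: cvg_near_cst; near=> n; rewrite /gn patchE mem_set//= in_itv/=.
  rewrite -ler_norml; apply: (@le_trans _ _ n%:R); last by rewrite ler_nat.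
  by near: n; exact: nbhs_infty_ger.
have gn_le : {ae mu, forall x n, setT x -> (`|gn n x| <= (abse \o (EFin \o g)) x)%E}.
  apply: aeW => x n _; rewrite /gn patchE; case: ifPn => _; first exact: lexx.
  by rewrite abse0; exact: abse_ge0.
have mEg : measurable_fun setT (EFin \o g) by exact/measurable_EFinP.
have [_ _ cv] := @dominated_convergence _ _ _ mu setT measurableT gn
  (EFin \o g) (abse \o (EFin \o g)) mgn mEg gng (integrable_abse ig) gn_le.
have lim0 : [sequence (\int[mu]_(x in setT) (gn n x))%E]_n @ \oo --> 0%E.
  have F0 : (F n.+1%:R - F (- n.+1%:R)) @[n --> \oo] --> (0 : R).
    apply: norm_cvg0.
    apply: (@squeeze_cvgr _ _ _ _ (cst 0) (fun n => (c * (normal_peak 1 * 4)) * harmonic n)).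
    - near=> n; rewrite normr_ge0/=.
      (* Since [pdf] is even, the two boundary terms share one factor, and the difference of the
         values of h is at most 2c. *)
      have -> : F n.+1%:R - F (- n.+1%:R) =
          (h (- n.+1%:R) - h n.+1%:R) * pdf n.+1%:R.
        by rewrite /F normal_pdfN; ring.
      rewrite normrM (ger0_norm (normal_pdf_ge0 _ _ _)).
      have -> : c * (normal_peak 1 * 4) * harmonic n =
          (c + c) * (normal_peak 1 * 2 * harmonic n) by ring.
      apply: ler_pM; rewrite ?normal_pdf_ge0//.
        by apply: (le_trans (ler_normB _ _)); exact: lerD.
      apply: (le_trans (normal_pdf_le_inv _)).
      rewrite ler_wpM2l ?mulr_ge0 ?normal_peak_ge0// /harmonic/=.
      by rewrite lef_pV2 ?posrE// ler_nat.
    - exact: cvg_cst.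
    - rewrite -[X in _ --> X](mulr0 (c * (normal_peak 1 * 4))).
      by apply: cvgM; [exact: cvg_cst|exact: cvg_harmonic].
  rewrite [X in X @ \oo](_ : _ = EFin \o (fun n : nat => F n.+1%:R - F (- n.+1%:R))).
    by apply: cvg_EFin; [exact: nearW|exact: F0].
  by apply/funext => n/=; rewrite -integral_mkcond/= FTC.
exact: (cvg_unique _ cv lim0).
Unshelve. all: by end_near.
Qed.

End OneDimensionalStein.

(** * Stein's identity for standard Gaussian vectors *)

Section ImageMeasure.
Context d d' (X : measurableType d) (Y : measurableType d') (R : realType).
Variables (mu : {measure set X -> \bar R}) (nu : {measure set Y -> \bar R}).
Variable f : X -> Y.
Hypothesis mf : measurable_fun setT f.
Hypothesis nuE : forall A, measurable A -> nu A = mu (f @^-1` A).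

(** The image relation is assumed setwise, in [nuE]: this is the form in which both coordinate
    resampling and [gaussian_law] provide it. *)
Lemma ge0_integral_image (h : Y -> \bar R) :
  (forall y, (0 <= h y)%E) -> measurable_fun setT h ->
  (\int[nu]_y h y = \int[mu]_x h (f x))%E.
Proof.
move=> h0 mh.
have := ge0_integral_pushforward mf mu measurableT mh (fun y _ => h0 y).
rewrite preimage_setT => <-.
by apply: eq_measure_integral => A mA _; exact: nuE.
Qed.

Lemma integrable_image (h : Y -> \bar R) : measurable_fun setT h ->
  nu.-integrable setT h <-> mu.-integrable setT (h \o f).
Proof.
move=> mh; split => /integrableP[_ ih]; apply/integrableP; split=> //.
- exact: measurableT_comp.
- move: ih; rewrite ge0_integral_image//; exact: measurableT_comp.
- rewrite ge0_integral_image//; exact: measurableT_comp.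
Qed.

Lemma integral_image (h : Y -> \bar R) : measurable_fun setT h ->
  (\int[nu]_y h y = \int[mu]_x h (f x))%E.
Proof.
move=> mh; rewrite integralE [RHS]integralE.
have mp := measurable_funepos mh; have mn := measurable_funeneg mh.
rewrite !ge0_integral_image//.
by congr (_ - _)%E; apply: eq_integral => x _; rewrite ?funeposE ?funenegE.
Qed.

Lemma Rintegral_image (h : Y -> R) : measurable_fun setT h ->
  \int[nu]_y h y = \int[mu]_x h (f x).
Proof.
by move=> mh; rewrite /Rintegral integral_image//; exact/measurable_EFinP.
Qed.

End ImageMeasure.

(** * Resampling one coordinate of a standard Gaussian vector *)

Section TupleStein.
Context {R : realType} {n : nat}.
Local Notation gauss := (normal_prob (0 : R) 1).
Variable N : probability (n.-tuple R) R.
Hypothesis stdN : std_gaussian N.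
Variable l : 'I_n.

Definition set_tnth (s : R) (t : n.-tuple R) : n.-tuple R :=
  [tuple if i == l then s else tnth t i | i < n].

Lemma measurable_set_tnth :
  measurable_fun setT (fun p : R * n.-tuple R => set_tnth p.1 p.2).
Proof.
apply/measurable_fun_tnthP => i.
rewrite (_ : _ \o _ = fun p : R * n.-tuple R => if i == l then p.1 else tnth p.2 i).
  case: (i == l); first exact: measurable_fst.
  exact: (measurableT_comp (measurable_tnth i) measurable_snd).
by apply/funext => p /=; rewrite tnth_mktuple.
Qed.

Definition box (B : 'I_n -> set R) : set (n.-tuple R) :=
  [set z | forall i, B i (tnth z i)].

Lemma measurable_box (B : 'I_n -> set R) :
  (forall i, measurable (B i)) -> measurable (box B).
Proof.
move=> mB; rewrite (_ : box B = \bigcap_(i in [set: 'I_n]) ((fun z => tnth z i) @^-1` B i)).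
  apply: fin_bigcap_measurable => // i _; rewrite -[X in measurable X]setTI.
  exact: measurable_tnth.
by apply/seteqP; split => [z Bz i _|z Bz i]; exact: Bz.
Qed.

(* Independence: resampling one coordinate preserves [N]; Fubini then reduces
   integrals to that coordinate. *)
Lemma std_gaussian_set_tnth (A : set (n.-tuple R)) : measurable A ->
  N A = (gauss \x N)%E ((fun p : R * n.-tuple R => set_tnth p.1 p.2) @^-1` A).
Proof.
move=> mA.
(* Boxes form a pi-system that generates the sigma-algebra, so two finite measures that agree on
   them are equal. *)
pose G : set (set (n.-tuple R)) :=
  [set X | exists B : 'I_n -> set R, (forall i, measurable (B i)) /\ X = box B].
have mG : measurable = <<s G >>.
  apply/seteqP; split.
    apply: smallest_sub; first exact: smallest_sigma_algebra.
    move=> X; rewrite -bigcup_seq => -[i /= _ [Y mY <-]].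
    apply: sub_sigma_algebra.
    exists (fun j => if j == i then Y else setT); split.
      by move=> j; case: ifP.
    rewrite setTI; apply/seteqP; split => [z Yz j|z /(_ i)/=]; rewrite ?eqxx//.
    by case: eqP => // ->.
  apply: smallest_sub; first exact: sigma_algebra_measurable.
  by move=> _ [B [mB ->]]; exact: measurable_box.
rewrite -[RHS]/(pushforward (gauss \x N)%E
  (fun p : R * n.-tuple R => set_tnth p.1 p.2) A).
apply: (measure_unique G (fun=> setT)) => //.
- move=> _ _ [B [mB ->]] [B' [mB' ->]].
  exists (fun i => B i `&` B' i); split; first by move=> i; exact: measurableI.
  apply/seteqP; split => [z [Bz B'z] i|z BB'z]; first by split.
  by split => i; have [] := BB'z i.
- move=> _; exists (fun=> setT); split => //.
  by apply/seteqP; split.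
- by rewrite bigcup_const//; exists 0%N.
- exact: measurable_set_tnth.
- move=> mset _ [B [mB ->]].
  change (N (box B) = (gauss \x N)%E ((fun p : R * n.-tuple R => set_tnth p.1 p.2) @^-1` box B)).
  rewrite (_ : _ @^-1` _ =
     B l `*` box (fun i => if i == l then setT else B i)); last first.
    apply/seteqP; split => [[s z]/= Bz|[s z]/= [Bl Bz] i].
      split => [|i]; first by have := Bz l; rewrite tnth_mktuple eqxx.
      by have := Bz i; rewrite tnth_mktuple; case: ifP.
    by rewrite tnth_mktuple; have := Bz i; case: eqP => [->|].
  have mB' i : measurable (if i == l then setT else B i) by case: ifP.
  have e1 : N (box B) = _ := stdN mB.
  have e2 : N (box (fun i => if i == l then setT else B i)) = _ := stdN mB'.
  (* The new coordinate carries the side [B l], while the box of the old vector is free at [l] and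
     so has the factor 1 there. *)
  transitivity (gauss (B l) * N (box (fun i => if i == l then setT else B i)))%E;
    last by symmetry; apply: product_measure1E; [exact: mB|exact: measurable_box].
  rewrite e1 e2.
  rewrite (bigD1 l)//= [in RHS](bigD1 l)//= eqxx.
  rewrite probability_setT mul1e; congr (_ * _)%E.
  by apply: eq_bigr => i /negPf ->.
- by move=> _; rewrite [X in (X < _)%E]probability_setT ltry.
Qed.

Lemma ge0_integral_set_tnth (f : n.-tuple R -> \bar R) :
  (forall z, (0 <= f z)%E) -> measurable_fun setT f ->
  (\int[N]_z f z = \int[N]_t \int[gauss]_s f (set_tnth s t))%E.
Proof.
move=> f0 mf.
rewrite (@ge0_integral_image _ _ _ _ _ (gauss \x N)%E N _
  measurable_set_tnth std_gaussian_set_tnth)//.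
rewrite fubini_tonelli2//.
by apply: measurableT_comp => //; exact: measurable_set_tnth.
Qed.

Lemma integral_set_tnth (f : n.-tuple R -> \bar R) :
  N.-integrable setT f ->
  (\int[N]_z f z = \int[N]_t \int[gauss]_s f (set_tnth s t))%E.
Proof.
move=> intf.
have mf := measurable_int _ intf.
have mfs : measurable_fun setT (f \o (fun p : R * n.-tuple R => set_tnth p.1 p.2)).
  by apply: measurableT_comp => //; exact: measurable_set_tnth.
have intfs : (gauss \x N)%E.-integrable setT
    (f \o (fun p : R * n.-tuple R => set_tnth p.1 p.2)).
  exact/(@integrable_image _ _ _ _ _ (gauss \x N)%E N _ measurable_set_tnth std_gaussian_set_tnth).
rewrite (@integral_image _ _ _ _ _ (gauss \x N)%E N _ measurable_set_tnth std_gaussian_set_tnth)//.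
by rewrite -integral21_prod_meas1.
Qed.

(** The product is dominated by c |z_l|, whose integral reduces by resampling to a first absolute
    moment in one dimension. *)
Lemma integrable_tnth_mul (g : n.-tuple R -> R) (c : R) :
  measurable_fun setT g -> (forall z, `|g z| <= c) ->
  N.-integrable setT (fun z => (tnth z l * g z)%:E).
Proof.
move=> mg gc.
have mt : measurable_fun setT (fun z : n.-tuple R => tnth z l).
  exact: measurable_tnth.
apply/integrableP; split.
  by apply/measurable_EFinP; exact: measurable_funM.
apply: (@le_lt_trans _ _ (\int[N]_z (c * `|tnth z l|)%:E)%E).
  apply: ge0_le_integral => //=.
  - by apply/measurable_EFinP/measurableT_comp => //; exact: measurable_funM.
  - apply/measurable_EFinP/measurable_funM => //.
    exact: measurableT_comp.
  - move=> z _; rewrite lee_fin normrM mulrC.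
    by rewrite ler_wpM2r.
rewrite ge0_integral_set_tnth//; last 2 first.
- by move=> z; rewrite lee_fin mulr_ge0// (le_trans _ (gc z)).
- apply/measurable_EFinP/measurable_funM => //.
  exact: measurableT_comp.
(* After resampling, the inner integral does not depend on [t]; it is named so that the outer one is
   that of a constant. *)
have [K KE] : exists K : \bar R, K = (\int[gauss]_s (c * `|s|)%:E)%E by eexists.
rewrite (eq_integral (fun=> K)); last first.
  by move=> t _; rewrite KE; apply: eq_integral => s _; rewrite tnth_mktuple eqxx.
rewrite integral_cst// [X in (_ * X)%E]probability_setT mule1 KE.
have mc : measurable_fun setT (fun x : R => c * `|x|).
  by apply: measurable_funM => //; exact: measurableT_comp.
rewrite integral_normal_prob; last exact/measurable_EFinP.
have /integrableP[_] : lebesgue_measure.-integrable setT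
    (fun x : R => (c * `|x| * normal_pdf 0 1 x)%:E).
  apply: (@integrable_linear_normal_pdf _ _ `|c|) => // x.
  rewrite normrM normr_id; apply: ler_wpM2l => //; lra.
apply: le_lt_trans; rewrite le_eqVlt; apply/orP; left; apply/eqP.
apply: eq_integral => x _; rewrite gee0_abs ?EFinM// -EFinM lee_fin !mulr_ge0 ?normal_pdf_ge0//.
exact: le_trans (normr_ge0 _) (gc (nseq_tuple n 0)).
Qed.

(** The difference of the two sides is resampled in coordinate [l]; with the other coordinates
    frozen, the inner integral vanishes by the one-dimensional identity. *)
Lemma std_gaussian_stein (g g' : n.-tuple R -> R) (c : R) :
  measurable_fun setT g -> measurable_fun setT g' ->
  (forall z, `|g z| <= c) -> (forall z, `|g' z| <= c) ->
  (forall t s, is_derive s (1:R) (fun s => g (set_tnth s t)) (g' (set_tnth s t))) ->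
  (forall t, continuous (fun s => g' (set_tnth s t))) ->
  \int[N]_z (tnth z l * g z) = \int[N]_z g' z.
Proof.
move=> mg mg' gc g'c dg cg'.
have i1 := integrable_tnth_mul mg gc.
have i2 : N.-integrable setT (EFin \o g').
  apply: measurable_bounded_integrable => //.
    by rewrite [X in (X < _)%E]probability_setT ltry.
  by exists c; split; [exact: num_real|move=> M cM z _; exact: le_trans (g'c z) (ltW cM)].
apply/eqP; rewrite -subr_eq0 -RintegralB//.
rewrite /Rintegral integral_set_tnth; last first.
  by have := integrableB measurableT i1 i2.
rewrite (eq_integral (fun=> 0%E)) ?integral0// => t _.
have mgs : measurable_fun setT (fun s : R => g (set_tnth s t)).
  apply: continuous_measurable_fun => s; apply: differentiable_continuous.
  by apply/derivable1_diffP; have [] := dg t s.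
have mgs' : measurable_fun setT (fun s : R => g' (set_tnth s t)).
  exact: continuous_measurable_fun.
transitivity (\int[gauss]_s (s * g (set_tnth s t) - g' (set_tnth s t))%:E)%E.
  by apply: eq_integral => s _; rewrite tnth_mktuple eqxx.
rewrite integral_normal_prob; last first.
  by apply/measurable_EFinP/measurable_funB => //; exact: measurable_funM.
rewrite -(@integral_derive_normal_pdf _ (fun s => g (set_tnth s t))
  (fun s => g' (set_tnth s t)) c)//.
Qed.
End TupleStein.

(** * Bounded measurable functions and the likelihood *)

Section MeasurableBounded.
Context d (T : measurableType d) (R : realType).
Implicit Types f g : T -> R.

(** This class lies in L^1 of every probability measure and is stable under linear combinations and
    integration against a probability kernel. The likelihood factor puts the moment integrands below
    into it. *)
Definition mbounded f := measurable_fun setT f /\ exists c, forall x, `|f x| <= c.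

Lemma eq_mbounded f g : f =1 g -> mbounded f -> mbounded g.
Proof. by move=> /funext ->. Qed.

Lemma mboundedD f g : mbounded f -> mbounded g -> mbounded (fun x => f x + g x).
Proof.
move=> [mf [c fc]] [mg [e ge]]; split; first exact: measurable_funD.
by exists (c + e) => x; apply: (le_trans (ler_normD _ _)); exact: lerD.
Qed.

Lemma mboundedZ k f : mbounded f -> mbounded (fun x => k * f x).
Proof.
move=> [mf [c fc]]; split; first exact: measurable_funM.
by exists (`|k| * c) => x; rewrite normrM ler_wpM2l.
Qed.

Lemma mbounded_sum (I : Type) (r : seq I) (f : I -> T -> R) :
  (forall i, mbounded (f i)) -> mbounded (fun x => \sum_(i <- r) f i x).
Proof.
move=> bf; elim: r => [|i r IH].
  apply: (@eq_mbounded (cst 0)); first by move=> x; rewrite big_nil.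
  by split => //; exists 0 => x; rewrite normr0.
by apply: eq_mbounded (mboundedD (bf i) IH) => x; rewrite big_cons.
Qed.

Lemma mbounded_integrable (mu : {measure set T -> \bar R}) f :
  mu setT = 1%E -> mbounded f -> mu.-integrable setT (EFin \o f).
Proof.
move=> mu1 [mf [c fc]]; apply: measurable_bounded_integrable => //.
  by rewrite mu1 ltry.
by exists c; split; [exact: num_real|move=> M cM z _; exact: le_trans (fc z) (ltW cM)].
Qed.

Lemma Rintegral_sum (mu : {measure set T -> \bar R}) (I : Type) (r : seq I) (f : I -> T -> R) :
  (forall i, mu.-integrable setT (EFin \o f i)) ->
  \int[mu]_x (\sum_(i <- r) f i x) = \sum_(i <- r) \int[mu]_x f i x.
Proof.
move=> intf.
have ints s : mu.-integrable setT (EFin \o (fun x => \sum_(i <- s) f i x)).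
  elim: s => [|i s IH].
    by under eq_fun do rewrite big_nil; exact: integrable0.
  have := integrableD measurableT (intf i) IH.
  by apply: eq_integrable => // x _ /=; rewrite big_cons EFinD.
elim: r => [|i r IH].
  rewrite big_nil; under eq_Rintegral do rewrite big_nil.
  by rewrite /Rintegral integral0.
rewrite big_cons -IH -RintegralD//.
by apply: eq_Rintegral => x _; rewrite big_cons.
Qed.

Lemma RintegralZD (mu : {measure set T -> \bar R}) k f g :
  mu setT = 1%E -> mbounded f -> mbounded g ->
  \int[mu]_x (k * f x + g x) = k * \int[mu]_x f x + \int[mu]_x g x.
Proof.
move=> mu1 bf bg; rewrite RintegralD//.
- by rewrite RintegralZl//; exact: mbounded_integrable.
- exact/mbounded_integrable/mboundedZ.
- exact: mbounded_integrable.
Qed.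

(** A zero integral would make f vanish almost everywhere; as f vanishes nowhere, the whole space
    would be null, against its mass 1. *)
Lemma Rintegral_gt0 (mu : {measure set T -> \bar R}) f :
  mu setT = 1%E -> mbounded f -> (forall x, 0 < f x) -> 0 < \int[mu]_x f x.
Proof.
move=> mu1 bf f0; have intf := mbounded_integrable mu1 bf.
rewrite lt_neqAle Rintegral_ge0 ?andbT => [|x _]; last exact: ltW.
apply/eqP => int0.
have /(ae_eq_integral_abs mu measurableT (measurable_int _ intf)) :
    (\int[mu]_x `|(EFin \o f) x| = 0)%E.
  under eq_integral => x _ do rewrite /= gtr0_norm ?f0//.
  by rewrite -[LHS]fineK ?integrable_fin_num// -/(Rintegral _ _ _) -int0.
case=> B [mB B0 fB].
have BT : B = setT.
  apply/seteqP; split => // x _; apply: fB => /= h.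
  by have := h Logic.I => -[] fx0; have := f0 x; rewrite fx0 ltxx.
by move: B0; rewrite BT mu1 => /eqP; rewrite onee_eq0.
Qed.

End MeasurableBounded.

Lemma is_derive_bigsum (R : realType) (I : Type) (r : seq I) (h : I -> R -> R)
    (dh : I -> R) (x : R) :
  (forall i, is_derive x (1:R) (h i) (dh i)) ->
  is_derive x (1:R) (fun s => \sum_(i <- r) h i s) (\sum_(i <- r) dh i).
Proof.
move=> hd; elim: r => [|i r IH].
  rewrite big_nil (_ : (fun _ => _) = cst 0); first exact: is_derive_cst.
  by apply/funext => s; rewrite big_nil.
rewrite big_cons (_ : (fun _ => _) = h i + (fun s => \sum_(i <- r) h i s)).
  exact: is_deriveD.
by apply/funext => s; rewrite big_cons.
Qed.

(** * Uniform bounds on the Gaussian likelihood *)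

Section ObservationLikelihood.
Context {R : realType} {I : finType}.
Variables y D : I -> R.
Hypothesis D0 : forall i, 0 < D i.

Definition obs_lik (f : I -> R) : R :=
  \prod_i normal_pdf (f i) (Num.sqrt (D i)) (y i).

Let s0 i : Num.sqrt (D i) != 0.
Proof. by rewrite gt_eqF// sqrtr_gt0. Qed.

Let pdfE m i : normal_pdf m (Num.sqrt (D i)) (y i) =
  normal_peak (Num.sqrt (D i)) * expR (- ((y i - m) ^+ 2 / (2 * D i))).
Proof.
by rewrite normal_pdfE// /normal_fun sqr_sqrtr ?ltW// -mulr_natl mulNr.
Qed.

Lemma obs_likE f : obs_lik f = (\prod_i normal_peak (Num.sqrt (D i))) *
  expR (- \sum_i (y i - f i) ^+ 2 / (2 * D i)).
Proof.
rewrite /obs_lik -sumrN expR_sum -big_split/=.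
by apply: eq_bigr => i _; rewrite pdfE.
Qed.

Lemma obs_lik_gt0 f : 0 < obs_lik f.
Proof.
rewrite obs_likE mulr_gt0 ?expR_gt0// prodr_gt0// => i _.
exact: normal_peak_gt0.
Qed.

(** The summand of index i bounds (1 + f_i^2) times the likelihood: its own factor absorbs the
    square and the other factors are at most their peaks. Summing over i makes the bound independent
    of the coordinate. *)
Definition obs_lik_ub : R :=
  \sum_i (1 + 2 * y i ^+ 2 + 4 * D i) * \prod_k normal_peak (Num.sqrt (D k)).

Let pdf_ub m i : (1 + m ^+ 2) * normal_pdf m (Num.sqrt (D i)) (y i) <=
  (1 + 2 * y i ^+ 2 + 4 * D i) * normal_peak (Num.sqrt (D i)).
Proof.
rewrite pdfE mulrCA mulrC ler_wpM2r ?normal_peak_ge0//.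
set t := (y i - m) ^+ 2 / (2 * D i).
have Di := D0 i.
have tE : (y i - m) ^+ 2 = t * (2 * D i).
  by rewrite /t divfK// gt_eqF// mulr_gt0.
have t0 : 0 <= t by rewrite /t divr_ge0 ?sqr_ge0// mulr_ge0 ?ltW.
have e0 : 0 < expR (- t) by exact: expR_gt0.
have te : t * expR (- t) <= 1.
  rewrite expRN ler_pdivrMr ?expR_gt0// mul1r.
  by have := expR_ge1Dx t; lra.
have e1 : expR (- t) <= 1 by rewrite -[leRHS]expR0 ler_expR oppr_le0.
have m2 : 1 + m ^+ 2 <= 1 + 2 * y i ^+ 2 + 4 * D i * t.
  (* This square is 2 y^2 + 2 (y - m)^2 - m^2, and 2 (y - m)^2 = 4 D t. *)
  have : 0 <= (2 * y i - m) ^+ 2 by rewrite sqr_ge0.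
  by nra.
apply: (le_trans (ler_wpM2r (ltW e0) m2)).
have h1 : (1 + 2 * y i ^+ 2) * expR (- t) <= 1 + 2 * y i ^+ 2.
  by rewrite -[leRHS]mulr1 ler_wpM2l// addr_ge0// mulr_ge0// sqr_ge0.
have h2 : 4 * D i * (t * expR (- t)) <= 4 * D i.
  by rewrite -[leRHS]mulr1 ler_wpM2l// mulr_ge0// ltW.
by rewrite mulrDl -(mulrA _ t); exact: lerD.
Qed.

Lemma obs_lik_le_ub f i : (1 + f i ^+ 2) * obs_lik f <= obs_lik_ub.
Proof.
apply: (@le_trans _ _ ((1 + 2 * y i ^+ 2 + 4 * D i) *
    \prod_k normal_peak (Num.sqrt (D k)))).
  rewrite /obs_lik (bigD1 i)//= [in leRHS](bigD1 i)//=.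
  rewrite (mulrA (1 + f i ^+ 2)) (mulrA (1 + 2 * y i ^+ 2 + 4 * D i)).
  apply: ler_pM.
  - by rewrite mulr_ge0 ?normal_pdf_ge0// addr_ge0// sqr_ge0.
  - by rewrite prodr_ge0// => k _; exact: normal_pdf_ge0.
  - exact: pdf_ub.
  - by apply: ler_prod => k _; rewrite normal_pdf_ge0/= normal_pdf_ub.
rewrite /obs_lik_ub [leRHS](bigD1 i)//= lerDl sumr_ge0// => k _.
rewrite mulr_ge0// ?prodr_ge0//.
  by rewrite !addr_ge0// mulr_ge0 ?sqr_ge0// ltW.
by move=> j _; exact: normal_peak_ge0.
Qed.

Lemma obs_lik_le f : obs_lik f <= \prod_k normal_peak (Num.sqrt (D k)).
Proof.
by apply: ler_prod => k _; rewrite normal_pdf_ge0/= normal_pdf_ub.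
Qed.

Lemma obs_lik_normM1 f i : `|f i * obs_lik f| <= obs_lik_ub.
Proof.
apply: le_trans (obs_lik_le_ub f i).
rewrite normrM (gtr0_norm (obs_lik_gt0 f)) ler_wpM2r ?ltW ?obs_lik_gt0//.
rewrite -(real_normK (num_real (f i))).
have : 0 <= (`|f i| - 1 / 2) ^+ 2 by rewrite sqr_ge0.
nra.
Qed.

Lemma obs_lik_normM2 f i k : `|f i * f k * obs_lik f| <= 2 * obs_lik_ub.
Proof.
have h1 := obs_lik_le_ub f i; have h2 := obs_lik_le_ub f k.
have l0 := obs_lik_gt0 f.
rewrite normrM (gtr0_norm l0).
apply: (@le_trans _ _ ((f i ^+ 2 + f k ^+ 2) * obs_lik f)); last first.
  have := mulr_ge0 (sqr_ge0 (f i)) (ltW l0).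
  have := mulr_ge0 (sqr_ge0 (f k)) (ltW l0).
  nra.
apply: ler_wpM2r; first exact: ltW.
rewrite normrM -(real_normK (num_real (f i))) -(real_normK (num_real (f k))).
have := normr_ge0 (f i); have := normr_ge0 (f k).
move: `|f i| `|f k| => a b b0 a0.
have := sqr_ge0 (a - b); have := mulr_ge0 a0 b0. lra.
Qed.

Section Measurability.
Context d (T : measurableType d).
Variable F : T -> I -> R.
Hypothesis mF : forall i, measurable_fun setT (F ^~ i).

Lemma mbounded_lik : mbounded (fun x => obs_lik (F x)).
Proof.
split; last first.
  exists (\prod_k normal_peak (Num.sqrt (D k))) => x.
  by rewrite gtr0_norm ?obs_lik_gt0// obs_lik_le.
under eq_fun do rewrite obs_likE.
apply: measurable_funM => //; apply: measurableT_comp => //.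
apply: measurableT_comp => //; apply: measurable_sum => i.
apply: measurable_funM => //; apply: measurable_funX.
exact: measurable_funB.
Qed.

Lemma mbounded_lik1 i : mbounded (fun x => F x i * obs_lik (F x)).
Proof.
split; first by apply: measurable_funM => //; have [] := mbounded_lik.
by exists obs_lik_ub => x; exact: obs_lik_normM1.
Qed.

Lemma mbounded_lik2 i k : mbounded (fun x => F x i * F x k * obs_lik (F x)).
Proof.
split; first by apply: measurable_funM; [exact: measurable_funM|have [] := mbounded_lik].
by exists (2 * obs_lik_ub) => x; exact: obs_lik_normM2.
Qed.

End Measurability.
End ObservationLikelihood.

(** * Posterior moments in a linear Gaussian model *)

Section GaussianPosterior.
Context {R : realType} {I : finType} {m : nat}.
Variables y D : I -> R.
Hypothesis D0 : forall i, 0 < D i.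

Lemma is_derive_obs_lik (f : R -> I -> R) (df : I -> R) (x : R) :
  (forall i, is_derive x (1:R) (f ^~ i) (df i)) ->
  is_derive x (1:R) (fun s => obs_lik y D (f s))
    ((\sum_i (y i - f x i) / D i * df i) * obs_lik y D (f x)).
Proof.
move=> hf.
(* The log-likelihood along the path, up to an additive constant; its derivative is the score. *)
pose S s := \sum_i - ((y i - f s i) ^+ 2 / (2 * D i)).
have dS : is_derive x (1:R) S (\sum_i (y i - f x i) / D i * df i).
  apply: is_derive_bigsum => i.
  have hi := hf i.
  have D0i : D i != 0 by rewrite gt_eqF.
  rewrite (_ : (fun _ => _) = (- (2 * D i)^-1) \*:
      ((cst (y i) - (f ^~ i)) * (cst (y i) - (f ^~ i)))); last first.
    apply/funext => s; change (- ((y i - f s i) ^+ 2 / (2 * D i)) =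
      - (2 * D i)^-1 * ((y i - f s i) * (y i - f s i))).
    by field.
  apply: is_derive_eq.
  change (- (2 * D i)^-1 * ((y i - f x i) * (0 - df i) + (y i - f x i) * (0 - df i)) =
    (y i - f x i) / D i * df i).
  by field.
have -> : (fun s => obs_lik y D (f s)) =
    (\prod_i normal_peak (Num.sqrt (D i))) \*: (expR \o S).
  by apply/funext => s; rewrite obs_likE//= /S sumrN.
apply: is_derive_eq; rewrite obs_likE// /S sumrN /GRing.scale/=.
by ring.
Qed.

Variables (a : I -> R) (H : I -> 'I_m -> R).

(** Instantiated below with the coordinates of theta^FHSC given the parameters, as functions of the
    standard Gaussian z behind the random effects. *)
Definition affine_obs (z : m.-tuple R) (i : I) : R :=
  a i + \sum_l H i l * tnth z l.

Local Notation F := affine_obs.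
Local Notation L z := (obs_lik y D (F z)).

Lemma measurable_affine_obs i : measurable_fun setT (F ^~ i).
Proof.
apply: measurable_funD => //; apply: measurable_sum => l.
by apply: measurable_funM => //; exact: measurable_tnth.
Qed.

Lemma is_derive_affine_obs (t : m.-tuple R) (l : 'I_m) (i : I) (s : R) :
  is_derive s (1:R) (fun s => F (set_tnth l s t) i) (H i l).
Proof.
have h (l' : 'I_m) : is_derive s (1:R)
    (fun s => H i l' * tnth (set_tnth l s t) l') (if l' == l then H i l else 0).
  case: eqP => [->|/eqP/negPf ll'].
    rewrite (_ : (fun _ => _) = H i l \*: id).
      by apply: is_derive_eq; rewrite /GRing.scale/= mulr1.
    by apply/funext => u; rewrite tnth_mktuple eqxx.
  rewrite (_ : (fun _ => _) = cst (H i l' * tnth t l')); first exact: is_derive_cst.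
  by apply/funext => u; rewrite tnth_mktuple ll'.
have := is_derive_bigsum (index_enum _) h.
rewrite -big_mkcond/= big_pred1_eq => d1.
rewrite (_ : (fun _ => _) = cst (a i) +
   (fun s => \sum_l' H i l' * tnth (set_tnth l s t) l')) //.
by apply: is_derive_eq; rewrite add0r.
Qed.

Variable N : probability (m.-tuple R) R.
Hypothesis stdN : std_gaussian N.

Let N1 : N setT = 1%E. Proof. exact: probability_setT. Qed.

(** The (i, k) entry of H H^T, the prior covariance of the affine coordinates. *)
Definition obs_cov (i k : I) : R := \sum_l H i l * H k l.

Let bL := mbounded_lik y D0 measurable_affine_obs.
Let bL1 := mbounded_lik1 y D0 measurable_affine_obs.
Let bL2 := mbounded_lik2 y D0 measurable_affine_obs.

(** The partial derivative in z_l of (al + be F_j) L, expanded into multiples of L, F L and F F L,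
    each of which is bounded. *)
Let grad (al be : R) (j : I) (l : 'I_m) (z : m.-tuple R) :=
  be * H j l * L z + \sum_k H k l / D k *
   (al * y k * L z - al * (F z k * L z) + be * y k * (F z j * L z)
     - be * (F z j * F z k * L z)).

Let bgrad al be j l : mbounded (grad al be j l).
Proof.
apply: mboundedD; first exact: mboundedZ.
apply: mbounded_sum => k; apply: mboundedZ.
apply: eq_mbounded (mboundedD (mboundedD (mboundedD (mboundedZ (al * y k) bL)
  (mboundedZ (- al) (bL1 k))) (mboundedZ (be * y k) (bL1 j)))
  (mboundedZ (- be) (bL2 j k))) => z.
by rewrite !mulNr.
Qed.

(* [be = 0] gives the equations of the first moments, [al = 0] those of the second. *)
Lemma affine_obs_stein (al be : R) (i j : I) :
  \int[N]_z ((F z i - a i) * ((al + be * F z j) * L z)) =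
  obs_cov i j * (be * \int[N]_z L z) + \sum_k obs_cov i k / D k *
   (al * y k * \int[N]_z L z - al * \int[N]_z (F z k * L z)
    + be * y k * \int[N]_z (F z j * L z)
    - be * \int[N]_z (F z j * F z k * L z)).
Proof.
have iB (g : m.-tuple R -> R) : mbounded g -> N.-integrable setT (EFin \o g).
  exact: mbounded_integrable N1.
pose g z := (al + be * F z j) * L z.
have bg : mbounded g.
  apply: eq_mbounded (mboundedD (mboundedZ al bL) (mboundedZ be (bL1 j))) => z.
  by rewrite /g /=; ring.
have [mg [c gc]] := bg.
have stein l : \int[N]_z (tnth z l * g z) = \int[N]_z grad al be j l z.
  have [mg' [c' g'c]] := bgrad al be j l.
  have dF t s i0 := is_derive_affine_obs t l i0 s.
  have dL t s : is_derive s (1:R) (fun s => L (set_tnth l s t))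
     ((\sum_i (y i - F (set_tnth l s t) i) / D i * H i l) * L (set_tnth l s t)).
    by apply: is_derive_obs_lik => i0; exact: dF.
  have cF t i0 : continuous (fun s => F (set_tnth l s t) i0).
    move=> s; apply: differentiable_continuous; apply/derivable1_diffP.
    by have [] := dF t s i0.
  have cL t : continuous (fun s => L (set_tnth l s t)).
    move=> s; apply: differentiable_continuous; apply/derivable1_diffP.
    by have [] := dL t s.
  (* Stein's identity takes one bound for both the function and its derivative. *)
  apply: (std_gaussian_stein stdN (c := Num.max c c')) => //.
  - by move=> z; rewrite le_max gc.
  - by move=> z; rewrite le_max g'c orbT.
  - move=> t s; have d1 := dF t s j; have d2 := dL t s.
    rewrite (_ : (fun s => g _) = (cst al + be \*: (fun s => F (set_tnth l s t) j))
       * (fun s => L (set_tnth l s t))) //.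
    apply: is_derive_eq; rewrite /grad; set z := set_tnth l s t.
    change ((al + be * F z j) * ((\sum_k (y k - F z k) / D k * H k l) * L z)
      + L z * (0 + be * H j l) = be * H j l * L z + \sum_k H k l / D k *
      (al * y k * L z - al * (F z k * L z) + be * y k * (F z j * L z)
        - be * (F z j * F z k * L z))).
    rewrite add0r addrC; congr (_ + _); first by rewrite mulrC.
    rewrite mulr_suml mulr_sumr; apply: eq_bigr => k _.
    have D0k : D k != 0 by rewrite gt_eqF.
    by field.
  - move=> t s; rewrite /grad.
    apply: cvgD; first by apply: cvgM; [exact: cvg_cst|exact: cL].
    apply: cvg_big => [|k _]; first exact: add_continuous.
    apply: cvgM; first exact: cvg_cst.
    have cFL k' : (fun s => F (set_tnth l s t) k' * L (set_tnth l s t)) s @[s --> s]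
       --> F (set_tnth l s t) k' * L (set_tnth l s t).
      by apply: cvgM; [exact: cF|exact: cL].
    apply: cvgB.
      apply: cvgD.
        apply: cvgB; first by apply: cvgM; [exact: cvg_cst|exact: cL].
        by apply: cvgM; [exact: cvg_cst|exact: cFL].
      by apply: cvgM; [exact: cvg_cst|exact: cFL].
    apply: cvgM; first exact: cvg_cst.
    by apply: cvgM; [apply: cvgM; exact: cF|exact: cL].
transitivity (\sum_l H i l * \int[N]_z (tnth z l * g z)).
  have it l : N.-integrable setT (EFin \o (fun z => tnth z l * g z)).
    exact: (integrable_tnth_mul stdN l mg gc).
  under [RHS]eq_bigr do rewrite -RintegralZl//.
  rewrite -Rintegral_sum.
    apply: eq_Rintegral => z _; rewrite /F addrAC subrr add0r mulr_suml.
    by apply: eq_bigr => l _; rewrite -mulrA.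
  move=> l; have := integrableZl measurableT (H i l) (it l).
  by apply: eq_integrable.
have int_grad l : \int[N]_z grad al be j l z =
  be * H j l * \int[N]_z L z + \sum_k H k l / D k *
   (al * y k * \int[N]_z L z - al * \int[N]_z (F z k * L z)
    + be * y k * \int[N]_z (F z j * L z) - be * \int[N]_z (F z j * F z k * L z)).
  have bk k : mbounded (fun z => al * y k * L z + (- al * (F z k * L z) +
      (be * y k * (F z j * L z) + - be * (F z j * F z k * L z)))).
    by do ?[exact: bL|exact: bL1|exact: bL2|apply: mboundedZ|apply: mboundedD].
  transitivity (\int[N]_z (be * H j l * L z + \sum_k H k l / D k *
      (al * y k * L z + (- al * (F z k * L z) +
      (be * y k * (F z j * L z) + - be * (F z j * F z k * L z)))))).
    apply: eq_Rintegral => z _; congr (_ + _); apply: eq_bigr => k _; congr (_ * _).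
    by ring.
  rewrite (RintegralZD _ N1)//; last by apply: mbounded_sum => k; exact: mboundedZ.
  congr (_ + _).
  rewrite Rintegral_sum; last by move=> k; apply/iB/mboundedZ.
  apply: eq_bigr => k _; rewrite RintegralZl//; last exact: iB.
  congr (_ * _).
  rewrite (RintegralZD _ N1)//; last first.
    by do ?[exact: bL|exact: bL1|exact: bL2|apply: mboundedZ|apply: mboundedD].
  rewrite (RintegralZD _ N1)//; last first.
    by do ?[exact: bL|exact: bL1|exact: bL2|apply: mboundedZ|apply: mboundedD].
  rewrite (RintegralZD _ N1)//; last exact: mboundedZ.
  rewrite RintegralZl//; last exact: iB.
  by ring.
(* Summing over the directions l turns the products H_il H_jl and H_il H_kl into entries of
   [obs_cov]. *)
under eq_bigr do rewrite stein int_grad mulrDr mulr_sumr.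
rewrite big_split/= exchange_big/=; congr (_ + _).
  by rewrite /obs_cov mulr_suml; apply: eq_bigr => l _; ring.
apply: eq_bigr => k _; rewrite /obs_cov !mulr_suml.
by apply: eq_bigr => l _; ring.
Qed.

(** The equation mu - a = K D^-1 (y - mu), multiplied through by the marginal likelihood. *)
Lemma affine_obs_mean (i : I) :
  \int[N]_z (F z i * L z) - a i * \int[N]_z L z =
  \sum_k obs_cov i k * ((y k * \int[N]_z L z - \int[N]_z (F z k * L z)) / D k).
Proof.
have := affine_obs_stein 1 0 i i.
rewrite (eq_Rintegral N (g := fun z => - a i * L z + F z i * L z)); last first.
  by move=> z _; ring.
rewrite (RintegralZD _ N1 bL (bL1 i)) mul0r mulr0 add0r mulNr addrC => ->.
by apply: eq_bigr => k _; ring.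
Qed.

(** Raw, unnormalised second moments; centring is left for later, where the mean equation is
    subtracted. *)
Lemma affine_obs_moment2 (i j : I) :
  \int[N]_z (F z i * F z j * L z) - a i * \int[N]_z (F z j * L z) =
  obs_cov i j * \int[N]_z L z + \sum_k obs_cov i k *
    ((y k * \int[N]_z (F z j * L z) - \int[N]_z (F z j * F z k * L z)) / D k).
Proof.
have := affine_obs_stein 0 1 i j.
rewrite (eq_Rintegral N (g := fun z => - a i * (F z j * L z) + F z i * F z j * L z)); last first.
  by move=> z _; ring.
rewrite (RintegralZD _ N1 (bL1 j) (bL2 i j)) mul1r mulNr addrC => ->.
by congr (_ + _); apply: eq_bigr => k _; ring.
Qed.

End GaussianPosterior.

(** * Solving for the posterior mean and covariance *)

Lemma invmx_unique (R : comUnitRingType) n (A B : 'M[R]_n) :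
  A *m B = 1%:M -> invmx A = B.
Proof.
by move=> AB; have [uA _] := mulmx1_unit AB; rewrite -[RHS](mulKmx uA) AB mulmx1.
Qed.

Section LinearSystem.
Context {F : fieldType} {n : nat}.
Variables A D Q : 'M[F]_n.
Hypotheses (uA : A \in unitmx) (sA : A^T = A) (uD : D \in unitmx) (uQ : Q \in unitmx).

(** For theta of prior covariance Q observed as y = A^-1 theta + e, with e of covariance D: [K] is
    the prior covariance of A^-1 theta, [P] the precision that y carries about theta, and [V] the
    posterior covariance of theta. *)
Let K := invmx A *m Q *m (invmx A)^T.
Let P := invmx (A *m D *m A^T).
Let V := invmx (P + invmx Q).

Let sAV : (invmx A)^T = invmx A.
Proof. by rewrite trmx_inv sA. Qed.

Let PE : P = invmx A *m invmx D *m invmx A.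
Proof.
apply: invmx_unique.
by rewrite sA !mulmxA (mulmxK uA) (mulmxK uD) mulmxV.
Qed.

(* The system itself forces P + Q^-1 to be invertible: A S A is its inverse. *)
Lemma posterior_cov_solve (S : 'M[F]_n) :
  S + K *m invmx D *m S = K ->
  [/\ P + invmx Q \in unitmx, S = invmx A *m V *m (invmx A)^T & V = A *m S *m A].
Proof.
move=> hS.
pose S' := A *m S *m A.
have h : (P + invmx Q) *m S' = 1%:M.
  have e : A *m (S + K *m invmx D *m S) *m A = A *m K *m A by rewrite hS.
  (* The system multiplied by A on both sides; a further left multiplication by Q^-1 exhibits S' as
     the inverse of P + Q^-1. *)
  have e1 : S' + Q *m P *m S' = Q.
    transitivity (A *m (S + K *m invmx D *m S) *m A).
      rewrite mulmxDr mulmxDl /S' PE /K sAV; congr (_ + _).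
      by rewrite !mulmxA (mulmxV uA) mul1mx mulmxKV// (mulmxKV uA).
    by rewrite e /K sAV !mulmxA (mulmxV uA) mul1mx mulmxKV.
  have := congr1 (mulmx (invmx Q)) e1.
  by rewrite mulmxDr mulVmx// -mulmxA (mulKmx uQ) => <-; rewrite mulmxDl addrC.
have [uPQ _] := mulmx1_unit h.
have VE : V = S' by rewrite -[S'](mulKmx uPQ) h mulmx1.
split=> //; rewrite VE.
by rewrite /S' sAV !mulmxA mulVmx// mul1mx mulmxK.
Qed.

(** Left multiplication by Q^-1 A gives the normal equations for A mu, with A a as prior mean of
    theta. The invertibility assumed here is supplied by [posterior_cov_solve]. *)
Lemma posterior_mean_solve (a y mu : 'cV[F]_n) :
  P + invmx Q \in unitmx ->
  mu - a = K *m invmx D *m (y - mu) ->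
  mu = invmx A *m (V *m (invmx A *m invmx D *m y + invmx Q *m (A *m a))).
Proof.
move=> uPQ hmu.
suff h : (P + invmx Q) *m (A *m mu) = invmx A *m invmx D *m y + invmx Q *m (A *m a).
  by rewrite -h (mulKmx uPQ) (mulKmx uA).
have e : invmx Q *m (A *m (mu - a)) = invmx A *m invmx D *m y - P *m (A *m mu).
  rewrite hmu /K sAV !mulmxA (mulmxK uA) (mulVmx uQ).
  by rewrite mul1mx mulmxBr PE (mulmxKV uA).
rewrite mulmxDl; move/eqP: e; rewrite !mulmxBr subr_eq => /eqP ->.
by rewrite addrA; congr (_ + _); rewrite addrC subrK.
Qed.

End LinearSystem.

(** * The matrix A_rho of one cluster and its inverse *)

Section ClusterMatrix.
Context {R : realType} {C : nat} {n : 'I_C -> nat}.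
Variables (r : R) (c : 'I_C).
Hypotheses (r01 : 0 < r <= 1) (n0 : (0 < n c)%N).
Local Notation A := (@A R C n r c).
Local Notation g := (@gam R C n r c).

Let r0 : r != 0. Proof. by case/andP: r01 => rgt0 _; rewrite gt_eqF. Qed.
Let den0 : (1 - r) * (n c)%:R + r != 0.
Proof.
case/andP: r01 => rgt0 r1; rewrite gt_eqF// ltr_wpDl// mulr_ge0// subr_ge0//.
Qed.
Let nn0 : (n c)%:R != 0 :> R. Proof. by rewrite pnatr_eq0 -lt0n. Qed.

Let ones : 'M[R]_(n c) := const_mx 1.

Let onesE : (const_mx 1 : 'cV[R]_(n c)) *m (const_mx 1 : 'cV[R]_(n c))^T = ones.
Proof. by apply/matrixP => i j; rewrite !mxE big_ord1 !mxE mulr1. Qed.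

Let ones2 : ones *m ones = (n c)%:R *: ones.
Proof.
apply/matrixP => i j; rewrite !mxE; under eq_bigr do rewrite !mxE mulr1.
by rewrite sumr_const card_ord mulr1.
Qed.

(** The all-ones matrix divided by n_c is the projection onto constant vectors. A_rho is 1 on
    constants and 1 / g on their orthogonal complement, so the inverse is 1 and g there. *)
Definition cluster_inv : 'M[R]_(n c) := g%:M + ((1 - g) / (n c)%:R) *: const_mx 1.

Lemma mul_cluster_inv : A *m cluster_inv = 1%:M.
Proof.
rewrite /A /= onesE /cluster_inv -/ones mulmxDl mul1mx mulmxDr.
rewrite -!scalemxAl !mulmxBl -!scalar_mxM -!scalemxAr ones2 !mul_scalar_mx mul_mx_scalar.
rewrite !scalerA.
apply/matrixP => i j; rewrite !mxE /gam.
case: (i == j); rewrite ?mulr1n ?mulr0n.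
  by field; rewrite ?r0 ?den0 ?nn0.
by field; rewrite ?r0 ?den0 ?nn0.
Qed.

Lemma cluster_unitmx : A \in unitmx.
Proof. by have [] := mulmx1_unit mul_cluster_inv. Qed.

Lemma cluster_invmx : invmx A = cluster_inv.
Proof. exact: invmx_unique mul_cluster_inv. Qed.

Lemma tr_cluster : A^T = A.
Proof.
rewrite /A /= onesE linearD/= linearZ/= linearB/= trmx1 tr_scalar_mx.
by rewrite /ones trmx_const.
Qed.

Lemma cluster_inv_mulE (v : 'cV[R]_(n c)) (j : 'I_(n c)) :
  (invmx A *m v) j ord0 =
  g * v j ord0 + (1 - g) * ((n c)%:R^-1 * \sum_(i < n c) v i ord0).
Proof.
rewrite cluster_invmx /cluster_inv mulmxDl mul_scalar_mx -scalemxAl !mxE.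
congr (_ + _); rewrite -mulrA; congr (_ * (_ * _)).
by apply: eq_bigr => i _; rewrite mxE mul1r.
Qed.

(** Symmetry of V identifies its row sum and column sum at j, which gives the cross term its factor
    2. *)
Lemma cluster_inv_conjE (V : 'M[R]_(n c)) (j : 'I_(n c)) : V^T = V ->
  (invmx A *m V *m (invmx A)^T) j j =
  g ^+ 2 * V j j
  + 2 * g * (1 - g) / (n c)%:R * (\sum_(i < n c) V j i)
  + (1 - g) ^+ 2 / (n c)%:R ^+ 2 * (\sum_(i < n c) \sum_(i' < n c) V i i').
Proof.
move=> sV.
have e (B : 'M[R]_(n c)) i k : (B *m cluster_inv) i k =
    g * B i k + (1 - g) / (n c)%:R * \sum_l B i l.
  rewrite /cluster_inv mulmxDr mul_mx_scalar -scalemxAr !mxE; congr (_ + _ * _).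
  by apply: eq_bigr => l _; rewrite mxE mulr1.
have e' (B : 'M[R]_(n c)) i k : (cluster_inv *m B) i k =
    g * B i k + (1 - g) / (n c)%:R * \sum_l B l k.
  rewrite /cluster_inv mulmxDl mul_scalar_mx -scalemxAl !mxE; congr (_ + _ * _).
  by apply: eq_bigr => l _; rewrite mxE mul1r.
rewrite trmx_inv tr_cluster cluster_invmx e.
under eq_bigr do rewrite e'.
rewrite e'.
rewrite big_split/= -!mulr_sumr exchange_big/=.
have -> : \sum_l V l j = \sum_i V j i.
  by apply: eq_bigr => i _; rewrite -[in LHS]sV mxE.
set s1 := \sum_i V j i.
set s2 := \sum_i _.
by field.
Qed.

End ClusterMatrix.

(** * Conditional moments in the FH-SC model *)

Lemma tuple_of_colK {R : realType} n (v : 'cV[R]_n) : col_of_tuple (tuple_of_col v) = v.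
Proof. by apply/colP => i; rewrite mxE tnth_mktuple. Qed.

Lemma measurable_linear_tuple {R : realType} n (S : 'M[R]_n) (v : 'cV[R]_n) :
  measurable_fun setT (fun z : n.-tuple R => tuple_of_col (v + S *m col_of_tuple z)).
Proof.
apply/measurable_fun_tnthP => i.
rewrite (_ : _ \o _ = fun z : n.-tuple R => v i ord0 + \sum_l S i l * tnth z l).
  apply: measurable_funD => //; apply: measurable_sum => l.
  by apply: measurable_funM => //; exact: measurable_tnth.
apply/funext => z /=; rewrite tnth_mktuple !mxE; congr (_ + _).
by apply: eq_bigr => l _; rewrite mxE.
Qed.

(* [powR] inverts nonnegative numbers only, hence the square. *)
Lemma measurable_inv (R : realType) : measurable_fun [set: R] (@GRing.inv R).
Proof.
rewrite (_ : GRing.inv = fun x : R => x * (x ^+ 2) `^ (- 1)).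
  apply: measurable_funM => //.
  by apply: (measurableT_comp (measurable_powR (- 1))); exact: measurable_funX.
apply/funext => x; rewrite powR_inv1 ?sqr_ge0//.
by have [->|x0] := eqVneq x 0; [rewrite invr0 mul0r|field].
Qed.

(** * Measurability of matrix-valued functions *)

Section MeasurableMatrix.
Context d (T : measurableType d) (R : realType).

Definition mxmeasurable k l (f : T -> 'M[R]_(k, l)) :=
  forall i j, measurable_fun setT (fun x => f x i j).

Lemma mxmeasurable_cst k l (A : 'M[R]_(k, l)) : mxmeasurable (fun=> A).
Proof. by move=> i j; exact: measurable_cst. Qed.

Lemma mxmeasurableD k l (f g : T -> 'M[R]_(k, l)) :
  mxmeasurable f -> mxmeasurable g -> mxmeasurable (fun x => f x + g x).
Proof.
by move=> mf mg i j; under eq_fun do rewrite mxE; exact: measurable_funD.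
Qed.

Lemma mxmeasurableZ k l (a : T -> R) (f : T -> 'M[R]_(k, l)) :
  measurable_fun setT a -> mxmeasurable f -> mxmeasurable (fun x => a x *: f x).
Proof.
by move=> ma mf i j; under eq_fun do rewrite mxE; exact: measurable_funM.
Qed.

Lemma mxmeasurableM k l o (f : T -> 'M[R]_(k, l)) (g : T -> 'M[R]_(l, o)) :
  mxmeasurable f -> mxmeasurable g -> mxmeasurable (fun x => f x *m g x).
Proof.
move=> mf mg i j; under eq_fun do rewrite mxE.
by apply: measurable_sum => s; exact: measurable_funM.
Qed.

Lemma mxmeasurable_tr k l (f : T -> 'M[R]_(k, l)) :
  mxmeasurable f -> mxmeasurable (fun x => (f x)^T).
Proof. by move=> mf i j; under eq_fun do rewrite mxE; exact: mf. Qed.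

Lemma measurable_det k (f : T -> 'M[R]_k) :
  mxmeasurable f -> measurable_fun setT (fun x => \det (f x)).
Proof.
move=> mf; apply: measurable_sum => s; apply: measurable_funM => //.
by apply: measurable_prod => i _; exact: mf.
Qed.

Lemma mxmeasurable_inv k (f : T -> 'M[R]_k) :
  mxmeasurable f -> mxmeasurable (fun x => invmx (f x)).
Proof.
move=> mf i j.
have mdet := measurable_det mf.
(* [invmx] returns a singular matrix unchanged, so the adjugate formula is used only where the
   determinant is nonzero. *)
rewrite (_ : (fun _ => _) = fun x =>
    if \det (f x) == 0 then f x i j else (\det (f x))^-1 * (\adj (f x)) i j).
  apply: measurable_fun_ifT; [exact: measurable_fun_eqr|exact: mf|].
  apply: measurable_funM; first exact: (measurableT_comp (@measurable_inv R) mdet).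
  under eq_fun do rewrite mxE.
  apply: measurable_funM => //; apply: measurable_det => s t.
  by under eq_fun do rewrite !mxE; exact: mf.
apply/funext => x; rewrite /invmx unitmxE unitfE.
by case: eqP => //= _; rewrite mxE.
Qed.

End MeasurableMatrix.

(** * The FH-SC model as a linear Gaussian model for fixed parameters *)

Section FHSCMoments.
Context {R : realType} {C : nat} {n p q : 'I_C -> nat}.
Context {d : measure_display} {Phi : measurableType d}.
Local Notation np := (\sum_(c < C) p c)%N.
Local Notation nq := (\sum_(c < C) q c)%N.
Variable M : fhsc_data R n p q.
Hypothesis hD : forall (c : 'I_C) (j : 'I_(n c)), 0 < direct_var M c ord0 j.
Local Notation par := ((np.-tuple R * Phi) * R)%type.
Local Notation area := {c : 'I_C & 'I_(n c)}.

(** Dependent pairs gather the areas of all clusters into a single finite index type, which turns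
    the double product of [lik] into an [obs_lik]. *)
Definition area_obs (i : area) : R := obs M (tag i) (tagged i) ord0.
Definition area_var (i : area) : R := direct_var M (tag i) ord0 (tagged i).
Definition area_thetaF (x : par) (u : nq.-tuple R) (i : area) : R :=
  thetaF M x u (tag i) (tagged i) ord0.

Lemma area_var_gt0 i : 0 < area_var i. Proof. exact: hD. Qed.

Lemma lik_obs_lik (x : par) (u : nq.-tuple R) :
  lik M x u = obs_lik area_obs area_var (area_thetaF x u).
Proof. by rewrite /lik sig_big_dep. Qed.

Lemma mxmeasurable_A c : mxmeasurable (fun r : R => @A R C n r c).
Proof.
apply: mxmeasurableD; first exact: mxmeasurable_cst.
apply: mxmeasurableZ; last exact: mxmeasurable_cst.
apply: measurable_funM; last exact: measurable_inv.
exact: measurable_funB.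
Qed.

Lemma mxmeasurable_submxcol d' (T : measurableType d') (s : 'I_C -> nat)
    (t : T -> (\sum_(c < C) s c).-tuple R) c :
  measurable_fun setT t -> mxmeasurable (fun x => submxcol (col_of_tuple (t x)) c).
Proof.
move=> mt i j; under eq_fun do rewrite !mxE.
exact: (measurableT_comp (measurable_tnth _) mt).
Qed.

(** Joint measurability in parameters and random effects, as integration against the kernel
    requires. *)
Lemma measurable_area_thetaF i :
  measurable_fun setT (fun xu : par * nq.-tuple R => area_thetaF xu.1 xu.2 i).
Proof.
have mr : measurable_fun setT (fun xu : par * nq.-tuple R => xu.1.2).
  exact: (measurableT_comp measurable_snd measurable_fst).
have md : measurable_fun setT (fun xu : par * nq.-tuple R => xu.1.1.1).
  apply: (measurableT_comp measurable_fst).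
  exact: (measurableT_comp measurable_fst measurable_fst).
suff : mxmeasurable (fun xu : par * nq.-tuple R => thetaF M xu.1 xu.2 (tag i)) by exact.
apply: mxmeasurableM.
  apply: mxmeasurable_inv => j k.
  exact: (measurableT_comp (@mxmeasurable_A (tag i) j k) mr).
apply: mxmeasurableD; apply: mxmeasurableM;
  do ?[exact: mxmeasurable_cst|exact: mxmeasurable_submxcol].
Qed.

Lemma measurable_area_thetaF_u x i :
  measurable_fun setT (fun u : nq.-tuple R => area_thetaF x u i).
Proof. exact: (measurableT_comp (measurable_area_thetaF i) (pair1_measurable x)). Qed.

Variable G : Phi -> forall c, 'M[R]_(q c).
Variable U : R.-pker Phi ~> nq.-tuple R.

Section FixedParameters.
Variable x : par.
Local Notation Ac c := (@A R C n x.2 c).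
Local Notation Z := (design_Z M).
Local Notation Xd c := (design_X M c *m submxcol (col_of_tuple x.1.1) c).
Local Notation D c := (diag_mx (direct_var M c)).

Variables (N : probability (nq.-tuple R) R) (S : 'M[R]_nq).
Hypothesis stdN : std_gaussian N.
Let N1 : N setT = 1%E. Proof. exact: probability_setT. Qed.
Hypothesis SE : S *m S^T = \mxdiag_c G x.1.2 c.
Hypothesis UE : forall B : set (nq.-tuple R), measurable B ->
  U x.1.2 B = N [set z | B (tuple_of_col (0 + S *m col_of_tuple z))].

(** The rows of H for cluster c: u_c is the block of S z with index c. *)
Let loading c : 'M[R]_(n c, nq) := invmx (Ac c) *m Z c *m submxcol S c.
Let a (i : area) : R := (invmx (Ac (tag i)) *m Xd (tag i)) (tagged i) ord0.
Let H (i : area) (l : 'I_nq) : R := loading (tag i) (tagged i) l.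

Lemma thetaF_affine (z : nq.-tuple R) :
  area_thetaF x (tuple_of_col (0 + S *m col_of_tuple z)) = affine_obs a H z.
Proof.
apply/funext => i; rewrite /area_thetaF /thetaF /theta tuple_of_colK add0r.
rewrite mulmxDr mxE -submxcol_mul !mulmxA; congr (_ + _); first by rewrite /a mulmxA.
by rewrite mxE; apply: eq_bigr => l _; rewrite [col_of_tuple _ _ _]mxE.
Qed.

Let K c : 'M[R]_(n c) := invmx (Ac c) *m ZGZ M G x c *m (invmx (Ac c))^T.

Lemma loading_cov c c' : loading c *m (loading c')^T =
  invmx (Ac c) *m Z c *m submxblock (\mxdiag_c G x.1.2 c) c c' *m (Z c')^T *m (invmx (Ac c'))^T.
Proof.
rewrite -SE submxblockEv -submxcol_mul -mul_submxrow -tr_submxcol.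
by rewrite /loading !trmx_mul !mulmxA.
Qed.

Lemma obs_cov_diag c (j k : 'I_(n c)) :
  obs_cov H (Tagged (fun c => 'I_(n c)) j) (Tagged (fun c => 'I_(n c)) k) = K c j k.
Proof.
transitivity ((loading c *m (loading c)^T) j k).
  by rewrite mxE; apply: eq_bigr => l _; rewrite [(loading _)^T _ _]mxE.
by rewrite loading_cov submxblock_diag /K /ZGZ !mulmxA.
Qed.

Lemma obs_cov_off c c' (j : 'I_(n c)) (k : 'I_(n c')) : c != c' ->
  obs_cov H (Tagged (fun c => 'I_(n c)) j) (Tagged (fun c => 'I_(n c)) k) = 0.
Proof.
move=> cc'.
transitivity ((loading c *m (loading c')^T) j k).
  by rewrite mxE; apply: eq_bigr => l _; rewrite [(loading _)^T _ _]mxE.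
rewrite loading_cov /mxdiag mxblockK (negPf cc').
by rewrite mulmx0 !mul0mx mxE.
Qed.

(** Blocks of the prior covariance for distinct clusters vanish because S S^T is block diagonal. The
    moment equations over all areas thus close up within each cluster. *)
Lemma sum_obs_cov c (j : 'I_(n c)) (f : area -> R) :
  \sum_k obs_cov H (Tagged (fun c => 'I_(n c)) j) k * f k =
  \sum_(k < n c) K c j k * f (Tagged (fun c => 'I_(n c)) k).
Proof.
transitivity (\sum_(c' < C) \sum_(k < n c')
  obs_cov H (Tagged (fun c => 'I_(n c)) j) (Tagged (fun c => 'I_(n c)) k) *
  f (Tagged (fun c => 'I_(n c)) k)).
  by rewrite sig_big_dep; apply: eq_bigr => -[].
rewrite (bigD1 c)//= [X in _ + X]big1 ?addr0.
  by apply: eq_bigr => k _; rewrite obs_cov_diag.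
move=> c' c'c; apply: big1 => k _.
by rewrite obs_cov_off ?mul0r// eq_sym.
Qed.

Local Notation F z := (affine_obs a H z).
Local Notation L z := (obs_lik area_obs area_var (affine_obs a H z)).
Local Notation idx k := (Tagged (fun c => 'I_(n c)) k).

Let mlik : mbounded (lik M x).
Proof.
apply: eq_mbounded (mbounded_lik area_obs area_var_gt0 (measurable_area_thetaF_u x)) => u.
by rewrite lik_obs_lik.
Qed.

Lemma Rintegral_random_effects (h : (area -> R) -> R) :
  measurable_fun setT (fun u => h (area_thetaF x u)) ->
  \int[U x.1.2]_u (h (area_thetaF x u) * lik M x u) = \int[N]_z (h (F z) * L z).
Proof.
move=> mh.
rewrite (Rintegral_image (measurable_linear_tuple S 0) UE); last first.
  by apply: measurable_funM => //; have [] := mlik.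
by apply: eq_Rintegral => z _; rewrite lik_obs_lik thetaF_affine.
Qed.

Lemma marg_lik_gaussian : marg_lik M U x = \int[N]_z L z.
Proof.
have := @Rintegral_random_effects (fun=> 1) (measurable_cst _).
rewrite (eq_Rintegral _ (g := lik M x)); last by move=> u _; rewrite mul1r.
by rewrite /marg_lik => ->; apply: eq_Rintegral => z _; rewrite mul1r.
Qed.

Lemma marg_lik_gaussian_gt0 : 0 < \int[N]_z L z.
Proof.
apply: (Rintegral_gt0 N1) => [|z]; last exact: obs_lik_gt0 area_var_gt0 _.
exact: (mbounded_lik area_obs area_var_gt0 (measurable_affine_obs a H)).
Qed.

Hypothesis x01 : 0 < x.2 <= 1.
Hypothesis uZGZ : forall c, ZGZ M G x c \in unitmx.
Variables (c : 'I_C) (j : 'I_(n c)).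

Let n0 : (0 < n c)%N. Proof. exact: leq_ltn_trans (leq0n j) (ltn_ord j). Qed.

Let uA : Ac c \in unitmx. Proof. exact: cluster_unitmx. Qed.

(** The marginal likelihood, by which integrals against the likelihood are normalised; [mu] and
    [cov] are then the conditional mean and covariance of theta^FHSC_c. *)
Let m0 := \int[N]_z L z.
Let mu : 'cV[R]_(n c) := \col_k (\int[N]_z (F z (idx k) * L z) / m0).
Let cov : 'M[R]_(n c) := \matrix_(k, l)
  (\int[N]_z (F z (idx k) * F z (idx l) * L z) / m0 - mu k ord0 * mu l ord0).

Let invD : invmx (D c) = diag_mx (\row_k (direct_var M c ord0 k)^-1).
Proof.
apply: invmx_unique; apply/matrixP => k l; rewrite mul_diag_mx !mxE.
by case: eqP => [->|_]; rewrite ?mulr0n ?mulr0// !mulr1n mulfV// gt_eqF.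
Qed.

Let uD : D c \in unitmx.
Proof.
rewrite unitmxE det_diag unitfE; apply/prodf_neq0 => k _.
by rewrite gt_eqF.
Qed.

Let m0_neq0 : m0 != 0. Proof. by rewrite gt_eqF// marg_lik_gaussian_gt0. Qed.

Let muE : mu - (\col_k a (idx k)) = K c *m invmx (D c) *m (obs M c - mu).
Proof.
apply/colP => k.
have := affine_obs_mean area_obs area_var_gt0 a H stdN (idx k).
rewrite -/m0 sum_obs_cov => e.
transitivity ((\int[N]_z (F z (idx k) * L z) - a (idx k) * m0) / m0).
  by rewrite !mxE mulrBl mulfK.
rewrite [RHS]mxE.
rewrite e mulr_suml; apply: eq_bigr => l _.
rewrite invD mul_mx_diag !mxE /area_obs /area_var/=.
have D0l : direct_var M c ord0 l != 0 by rewrite gt_eqF.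
by field; rewrite D0l m0_neq0.
Qed.

(** The second-moment equation divided by [m0] ([e2]), combined with [mu l ord0] times the mean
    equation ([e3]); the sums over i cancel and the moments become centred. *)
Let covE : cov + K c *m invmx (D c) *m cov = K c.
Proof.
apply/matrixP => k l; rewrite [LHS]mxE [X in _ + X]mxE.
have e1 : mu k ord0 - a (idx k) =
    \sum_(i < n c) K c k i * ((obs M c i ord0 - mu i ord0) / direct_var M c ord0 i).
  transitivity ((mu - (\col_k a (idx k))) k ord0); first by rewrite !mxE.
  rewrite muE [LHS]mxE.
  by apply: eq_bigr => i _; rewrite invD mul_mx_diag !mxE; ring.
have := affine_obs_moment2 area_obs area_var_gt0 a H stdN (idx k) (idx l).
rewrite -/m0 sum_obs_cov obs_cov_diag => e.
have e2 : \int[N]_z (F z (idx k) * F z (idx l) * L z) / m0 =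
    a (idx k) * mu l ord0 + K c k l + \sum_(i < n c) K c k i *
      ((obs M c i ord0 * mu l ord0 -
        \int[N]_z (F z (idx l) * F z (idx i) * L z) / m0) / direct_var M c ord0 i).
  move: e; set s := \sum_(i < n c) _; set t := \sum_(i < n c) _ => e.
  have -> : t = s / m0.
    rewrite mulr_suml; apply: eq_bigr => i _; rewrite /area_obs /area_var/= !mxE.
    have D0i : direct_var M c ord0 i != 0 by rewrite gt_eqF.
    by field; rewrite D0i m0_neq0.
  move/eqP : e; rewrite subr_eq => /eqP ->.
  by rewrite [mu l ord0]mxE; field.
have e3 : \sum_i (K c *m invmx (D c)) k i * cov i l =
    (mu k ord0 - a (idx k)) * mu l ord0 - \sum_(i < n c) K c k i *
      ((obs M c i ord0 * mu l ord0 -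
        \int[N]_z (F z (idx l) * F z (idx i) * L z) / m0) / direct_var M c ord0 i).
  rewrite e1 mulr_suml -sumrB; apply: eq_bigr => i _.
  rewrite invD mul_mx_diag [cov i l]mxE.
  rewrite (eq_Rintegral _ (g := fun z => F z (idx l) * F z (idx i) * L z)); last first.
    by move=> z _; rewrite [F z (idx i) * _]mulrC.
  rewrite [(\matrix_(i, j) _) k i]mxE [(\row_k _) _ i]mxE.
  by ring.
rewrite e3 [cov k l]mxE e2.
by ring.
Qed.

(** The covariance equation is solved first, since it yields the invertibility that the mean
    equation needs. [cf_V] is symmetric because it equals A cov A with A and [cov] symmetric. *)
Lemma cluster_posterior :
  mu = invmx (Ac c) *m cf_E M G x c /\
  [/\ cov = invmx (Ac c) *m cf_V M G x c *m (invmx (Ac c))^T &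
      (cf_V M G x c)^T = cf_V M G x c].
Proof.
have sA := @tr_cluster R C n x.2 c.
have [uV covV VE] := posterior_cov_solve uA sA uD (uZGZ c) covE.
split; last first.
  split => //.
  have -> : cf_V M G x c = Ac c *m cov *m Ac c by exact: VE.
  rewrite !trmx_mul sA mulmxA; congr (_ *m _ *m _).
  apply/matrixP => k l; rewrite !mxE.
  rewrite (eq_Rintegral _ (g := fun z => F z (idx k) * F z (idx l) * L z)); last first.
    by move=> z _; rewrite [F z (idx l) * _]mulrC.
  by congr (_ - _); rewrite mulrC.
rewrite [LHS](posterior_mean_solve uA sA uD (uZGZ c) uV muE).
congr (_ *m (_ *m (_ + _ *m _))).
have -> : \col_k a (idx k) = invmx (Ac c) *m Xd c by apply/colP => k; rewrite mxE.
by rewrite mulKVmx.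
Qed.

Lemma cond_exp_gaussian (h : (area -> R) -> R) :
  measurable_fun setT (fun u => h (area_thetaF x u)) ->
  cond_exp M U x (fun u => h (area_thetaF x u)) = (\int[N]_z (h (F z) * L z)) / m0.
Proof.
by move=> mh; rewrite /cond_exp Rintegral_random_effects// marg_lik_gaussian.
Qed.

Lemma cond_exp_closed_form :
  cond_exp M U x (fun u => thetaF M x u c j ord0) = cf_EF M G x j.
Proof.
have [muV _] := cluster_posterior.
have := @cond_exp_gaussian (fun f => f (idx j)) (measurable_area_thetaF_u x _).
rewrite /area_thetaF/= => ->.
rewrite /cf_EF -cluster_inv_mulE// -muV.
by rewrite [RHS]mxE.
Qed.

Lemma cond_var_closed_form :
  cond_var M U x (fun u => thetaF M x u c j ord0) = cf_VF M G x j.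
Proof.
have [_ [covV sV]] := cluster_posterior.
have bL := mbounded_lik area_obs area_var_gt0 (measurable_affine_obs a H).
have bL1 := mbounded_lik1 area_obs area_var_gt0 (measurable_affine_obs a H).
have bL2 := mbounded_lik2 area_obs area_var_gt0 (measurable_affine_obs a H).
rewrite /cf_VF -cluster_inv_conjE// -covV [RHS]mxE.
rewrite /cond_var; set e := cond_exp M U x (fun u => thetaF M x u c j ord0).
have eE : e = mu j ord0.
  have := @cond_exp_gaussian (fun f => f (idx j)) (measurable_area_thetaF_u x _).
  by rewrite /e /area_thetaF/= => ->; rewrite [RHS]mxE.
have mh : measurable_fun setT (fun u => (area_thetaF x u (idx j) - e) ^+ 2).
  by apply: measurable_funX; apply: measurable_funB => //; exact: measurable_area_thetaF_u.
have := @cond_exp_gaussian (fun f => (f (idx j) - e) ^+ 2) mh.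
rewrite /area_thetaF/= => ->.
rewrite (eq_Rintegral _ (g := fun z => (- 2 * e) * (F z (idx j) * L z) +
   (e ^+ 2 * L z + F z (idx j) * F z (idx j) * L z))); last by move=> z _; ring.
rewrite (RintegralZD _ N1 (bL1 _) (mboundedD (mboundedZ _ bL) (bL2 _ _))).
rewrite (RintegralZD _ N1 bL (bL2 _ _)) -/m0 eE.
rewrite -[\int[N]_z (F z (idx j) * L z)](divfK m0_neq0).
have -> : \int[N]_z (F z (idx j) * L z) / m0 = mu j ord0 by rewrite mxE.
by field.
Qed.

End FixedParameters.
End FHSCMoments.

(** * Posterior expectations and MCMC averages *)

Lemma cvg_average_drop (R : realType) (a : nat -> R) (l : R) (T : nat) :
  L%:R^-1 * (\sum_(1 <= i < L.+1) a i) @[L --> \oo] --> l ->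
  (L - T)%:R^-1 * (\sum_(T.+1 <= i < L.+1) a i) @[L --> \oo] --> l.
Proof.
(* Shifting by T + 1 turns L - T into L + 1, which is never zero. The truncated average is then 1 +
   T / (L + 1) times the full one, minus the fixed sum of the first T terms over L + 1. *)
move=> al; rewrite -(cvg_shiftn T.+1) /=.
pose S L := \sum_(1 <= i < L.+1) a i.
rewrite (_ : (fun L : nat => _) = (fun L : nat =>
   (1 + T%:R * harmonic L) * ((L + T.+1)%:R^-1 * S (L + T.+1)%N) - harmonic L * S T)).
  have al' : (L + T.+1)%:R^-1 * S (L + T.+1)%N @[L --> \oo] --> l.
    by rewrite (cvg_shiftn T.+1 (fun L => L%:R^-1 * S L)).
  have h0 : (@harmonic R) @ \oo --> (0 : R) by exact: cvg_harmonic.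
  have -> : l = (1 + T%:R * 0) * l - 0 * S T by ring.
  apply: cvgB; last by apply: cvgM => //; exact: cvg_cst.
  apply: cvgM => //; apply: cvgD; first exact: cvg_cst.
  by apply: cvgM => //; exact: cvg_cst.
apply/funext => L; rewrite /harmonic/=.
have -> : (L + T.+1 - T = L.+1)%N by rewrite addnS -addSn addnK.
have -> : \sum_(T.+1 <= i < (L + T.+1).+1) a i = S (L + T.+1)%N - S T.
  have -> : S (L + T.+1)%N = S T + \sum_(T.+1 <= i < (L + T.+1).+1) a i.
    by apply: big_cat_nat => //; rewrite ltnS -addSnnS leq_addl.
  by rewrite addrC addKr.
have L0 : L.+1%:R != 0 :> R by rewrite pnatr_eq0.
have LT0 : L.+1%:R + T%:R != 0 :> R by rewrite -natrD pnatr_eq0.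
rewrite addnS -addSn natrD.
move: L.+1%:R L0 LT0 (S _) => u L0 LT0 s.
by field; rewrite L0 LT0.
Qed.

(** * Bounded functions integrated against a probability kernel *)

Section KernelIntegral.
Context d d' (X : measurableType d) (Y : measurableType d') (R : realType).

Lemma mbounded_kernel_integral (kappa : R.-pker X ~> Y) (k : X * Y -> R) :
  mbounded k -> mbounded (fun x => \int[kappa x]_y k (x, y)).
Proof.
move=> bk; have [mk [c kc]] := bk.
have bkx x : mbounded (fun y => k (x, y)).
  split; last by exists c.
  exact: (measurableT_comp mk (pair1_measurable x)).
have k1 x : kappa x setT = 1%E by exact: prob_kernel.
split.
  (* shifted to be nonnegative, as [measurable_fun_integral_finite_kernel] requires *)
  pose k' xy := ((k xy + c)%:E).
  have k'0 xy : (0 <= k' xy)%E.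
    by rewrite lee_fin; have := kc xy; rewrite ler_norml => /andP[]; lra.
  have mk' : measurable_fun setT k'.
    by apply/measurable_EFinP; exact: measurable_funD.
  have mI := measurable_fun_integral_finite_kernel _ kappa k'0 mk'.
  rewrite (_ : (fun x => _) = fun x => fine (\int[kappa x]_y k' (x, y)) - c).
    by apply: measurable_funB => //; apply: (measurableT_comp (fine_measurable measurableT) mI).
  apply/funext => x; rewrite -/(Rintegral _ _ (fun y => k (x, y) + c)).
  rewrite RintegralD//; [|exact: mbounded_integrable (k1 x) _|].
    by rewrite Rintegral_cst// k1 mulr1 addrK.
  by apply: (mbounded_integrable (k1 x)); split => //; exists `|c|.
exists c => x.
apply: (le_trans (le_normr_Rintegral _ (mbounded_integrable (k1 x) (bkx x)))) => //.
apply: (@le_trans _ _ (\int[kappa x]_y (cst c y))); last first.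
  by rewrite Rintegral_cst// k1 mulr1.
apply: le_Rintegral => //.
- exact/integrable_norm/(mbounded_integrable (k1 x)).
- by apply: (mbounded_integrable (k1 x)); split => //; exists `|c|.
Qed.

End KernelIntegral.

(** * Posterior integrals and the mean square error *)

Section FHSCPosterior.
Context {R : realType} {C : nat} {n p q : 'I_C -> nat}.
Context {d : measure_display} {Phi : measurableType d}.
Local Notation np := (\sum_(c < C) p c)%N.
Local Notation nq := (\sum_(c < C) q c)%N.
Local Notation par := ((np.-tuple R * Phi) * R)%type.
Variable M : fhsc_data R n p q.
Hypothesis hD : forall (c : 'I_C) (j : 'I_(n c)), 0 < direct_var M c ord0 j.
Variable G : Phi -> forall c, 'M[R]_(q c).
Hypothesis mG : forall (c : 'I_C) (i j : 'I_(q c)),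
  measurable_fun setT (fun f => G f c i j).
Hypothesis hG : forall (f : Phi) (c : 'I_C),
  design_Z M c *m G f c *m (design_Z M c)^T \in unitmx.
Variable U : R.-pker Phi ~> nq.-tuple R.
Hypothesis hU : random_effects_law G U.
Variable prior : probability par R.
Hypothesis hrho : {ae prior, forall x, 0 < x.2 <= 1}.
Variables (c : 'I_C) (j : 'I_(n c)).

Lemma conditional_moments (x : par) : 0 < x.2 <= 1 ->
  cond_exp M U x (fun u => thetaF M x u c j ord0) = cf_EF M G x j /\
  cond_var M U x (fun u => thetaF M x u c j ord0) = cf_VF M G x j.
Proof.
move=> x01; have [N [S [stdN SE UE]]] := hU x.1.2.
have uQ c' : ZGZ M G x c' \in unitmx by exact: hG.
split; first exact: (cond_exp_closed_form hD stdN SE UE).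
exact: (cond_var_closed_form hD stdN SE UE).
Qed.

Local Notation f x u := (thetaF M x u c j ord0).

(** [U] seen as a kernel from the whole parameter space, so that integrands may depend on delta and
    rho as well as on phi. *)
Definition param_kernel (x : par) : {measure set (nq.-tuple R) -> \bar R} := U x.1.2.

Let U1 x : U x setT = 1%E. Proof. exact: prob_kernel. Qed.
Let prior1 : prior setT = 1%E. Proof. exact: probability_setT. Qed.

Let measurable_param_kernel (B : set (nq.-tuple R)) :
  measurable B -> measurable_fun setT (param_kernel ^~ B).
Proof.
move=> mB; apply: (measurableT_comp (measurable_kernel U _ mB)).
exact: (measurableT_comp measurable_snd measurable_fst).
Qed.

HB.instance Definition _ := isKernel.Build _ _ _ _ _ param_kernel measurable_param_kernel.

Let param_kernel_prob x : param_kernel x setT = 1%E.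
Proof. exact: prob_kernel. Qed.

HB.instance Definition _ :=
  Kernel_isProbability.Build _ _ _ _ _ param_kernel param_kernel_prob.

Let mbounded_param (k : par * nq.-tuple R -> R) : mbounded k ->
  mbounded (fun x => \int[U x.1.2]_u k (x, u)).
Proof. exact: (mbounded_kernel_integral param_kernel). Qed.

Let bk0 : mbounded (fun xu : par * nq.-tuple R => lik M xu.1 xu.2).
Proof.
apply: eq_mbounded (mbounded_lik (area_obs M) (area_var_gt0 hD)
  (measurable_area_thetaF M)) => xu.
by rewrite lik_obs_lik.
Qed.

Let idx := Tagged (fun c => 'I_(n c)) j.

Let bk1 : mbounded (fun xu : par * nq.-tuple R => f xu.1 xu.2 * lik M xu.1 xu.2).
Proof.
apply: eq_mbounded (mbounded_lik1 (area_obs M) (area_var_gt0 hD)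
  (measurable_area_thetaF M) idx) => xu.
by rewrite lik_obs_lik.
Qed.

Let bk2 : mbounded (fun xu : par * nq.-tuple R =>
  f xu.1 xu.2 * f xu.1 xu.2 * lik M xu.1 xu.2).
Proof.
apply: eq_mbounded (mbounded_lik2 (area_obs M) (area_var_gt0 hD)
  (measurable_area_thetaF M) idx idx) => xu.
by rewrite lik_obs_lik.
Qed.

(** Unnormalised conditional moments: the weight [marg_lik] in [post_exp] cancels the division in
    [cond_exp], so the prior integrates these bounded functions. *)
Let I1 (x : par) : R := \int[U x.1.2]_u (f x u * lik M x u).
Let I2 (x : par) : R := \int[U x.1.2]_u (f x u * f x u * lik M x u).

Let bI0 : mbounded (marg_lik M U). Proof. exact: mbounded_param bk0. Qed.
Let bI1 : mbounded I1. Proof. exact: mbounded_param bk1. Qed.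
Let bI2 : mbounded I2. Proof. exact: mbounded_param bk2. Qed.

Let mbounded_slice (k : par * nq.-tuple R -> R) (x : par) :
  mbounded k -> mbounded (fun u => k (x, u)).
Proof.
move=> [mk [e ke]]; split; last by exists e.
exact: (measurableT_comp mk (pair1_measurable x)).
Qed.

Lemma marg_lik_gt0 (x : par) : 0 < marg_lik M U x.
Proof.
apply: (Rintegral_gt0 (U1 _)) => [|u]; first exact: (mbounded_slice x bk0).
by rewrite lik_obs_lik; exact: obs_lik_gt0 (area_var_gt0 hD) _.
Qed.

Lemma evidence_gt0 : 0 < evidence M U prior.
Proof. by apply: (Rintegral_gt0 prior1) => // x; exact: marg_lik_gt0. Qed.

Lemma cond_exp_sqr_error (t : R) (x : par) :
  cond_exp M U x (fun u => (t - f x u) ^+ 2) =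
  (t ^+ 2 * marg_lik M U x + (- 2 * t * I1 x + I2 x)) / marg_lik M U x.
Proof.
have b0 := mbounded_slice x bk0; have b1 := mbounded_slice x bk1.
have b2 := mbounded_slice x bk2.
rewrite /cond_exp; congr (_ / _).
rewrite (eq_Rintegral _ (g := fun u => t ^+ 2 * lik M x u +
  (- 2 * t * (f x u * lik M x u) + f x u * f x u * lik M x u))); last first.
  by move=> u _; ring.
rewrite (RintegralZD _ (U1 _) b0 (mboundedD (mboundedZ _ b1) b2)).
by rewrite (RintegralZD _ (U1 _) b1 b2).
Qed.

Let E1 := \int[prior]_x I1 x.
Let E2 := \int[prior]_x I2 x.

Lemma theta_hatE : theta_hat M U prior j = E1 / evidence M U prior.
Proof.
rewrite /theta_hat /post_exp; congr (_ / _); apply: eq_Rintegral => x _.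
by rewrite /cond_exp divfK// gt_eqF// marg_lik_gt0.
Qed.

Lemma CPMSE_expand (t : R) : CPMSE M U prior t j =
  t ^+ 2 - 2 * t * theta_hat M U prior j + E2 / evidence M U prior.
Proof.
have e0 : evidence M U prior != 0 by rewrite gt_eqF// evidence_gt0.
rewrite theta_hatE /CPMSE /post_exp.
rewrite (eq_Rintegral _ (g := fun x => t ^+ 2 * marg_lik M U x +
   (- 2 * t * I1 x + I2 x))); last first.
  by move=> x _; rewrite cond_exp_sqr_error divfK// gt_eqF// marg_lik_gt0.
rewrite (RintegralZD _ prior1 bI0 (mboundedD (mboundedZ _ bI1) bI2)).
rewrite (RintegralZD _ prior1 bI1 bI2) -/(evidence M U prior) -/E1 -/E2.
by field.
Qed.

(** Given the data, t is a constant and the CPMSE is a monic quadratic in t with vertex at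
    [theta_hat]; this completes the square. *)
Lemma CPMSE_decomposition (t : R) : CPMSE M U prior t j =
  (t - theta_hat M U prior j) ^+ 2 + CPMSE M U prior (theta_hat M U prior j) j.
Proof. by rewrite !CPMSE_expand; ring. Qed.

Let cf_sqr_error (t : R) (x : par) : R := cf_VF M G x j + (cf_EF M G x j - t) ^+ 2.

(** Bias-variance decomposition under the conditional law given the parameters. *)
Lemma cf_sqr_errorE (t : R) (x : par) : 0 < x.2 <= 1 ->
  cf_sqr_error t x = cond_exp M U x (fun u => (t - f x u) ^+ 2).
Proof.
move=> x01; have [eE eV] := conditional_moments x01.
rewrite /cf_sqr_error -eV -eE /cond_var.
set e := cond_exp M U x (fun u => f x u).
rewrite (_ : (fun u => (f x u - e) ^+ 2) = (fun u => (e - f x u) ^+ 2)); last first.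
  by apply/funext => u; rewrite -sqrrN opprB.
have m0 : marg_lik M U x != 0 by rewrite gt_eqF// marg_lik_gt0.
have I1E : I1 x = e * marg_lik M U x by rewrite /e /cond_exp divfK.
by rewrite !cond_exp_sqr_error I1E; field.
Qed.

(** The ergodic theorem asks for measurability on the whole parameter space, while the closed forms
    are identified with moments only for 0 < rho <= 1. Measurability is therefore read off the
    formulas. *)
Lemma mxmeasurable_ZGZ c' : mxmeasurable (fun x : par => ZGZ M G x c').
Proof.
apply: mxmeasurableM; last exact: mxmeasurable_cst.
apply: mxmeasurableM; first exact: mxmeasurable_cst.
move=> i k; apply: (measurableT_comp (mG i k)).
exact: (measurableT_comp measurable_snd measurable_fst).
Qed.

Let mA : mxmeasurable (fun x : par => @A R C n x.2 c).
Proof. by move=> i k; exact: (measurableT_comp (@mxmeasurable_A _ _ n c i k) measurable_snd). Qed.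

Lemma mxmeasurable_cf_V : mxmeasurable (fun x : par => cf_V M G x c).
Proof.
apply: mxmeasurable_inv; apply: mxmeasurableD; apply: mxmeasurable_inv; last first.
  exact: mxmeasurable_ZGZ.
apply: mxmeasurableM; last exact: mxmeasurable_tr.
apply: mxmeasurableM => //; exact: mxmeasurable_cst.
Qed.

Lemma mxmeasurable_cf_E : mxmeasurable (fun x : par => cf_E M G x c).
Proof.
apply: mxmeasurableM; first exact: mxmeasurable_cf_V.
apply: mxmeasurableD.
  apply: mxmeasurableM; last exact: mxmeasurable_cst.
  exact: (mxmeasurableM (mxmeasurable_inv mA) (mxmeasurable_cst _)).
apply: mxmeasurableM; first exact: (mxmeasurable_inv (@mxmeasurable_ZGZ c)).
apply: mxmeasurableM; first exact: mxmeasurable_cst.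
apply: mxmeasurable_submxcol.
exact: (measurableT_comp measurable_fst measurable_fst).
Qed.

Let mgam : measurable_fun setT (fun x : par => @gam R C n x.2 c).
Proof.
apply: measurable_funM => //.
apply: (measurableT_comp (@measurable_inv R)).
apply: measurable_funD => //; apply: measurable_funM => //.
exact: measurable_funB.
Qed.

Lemma measurable_cf_EF : measurable_fun setT (fun x : par => cf_EF M G x j).
Proof.
apply: measurable_funD; apply: measurable_funM => //.
- exact: mxmeasurable_cf_E.
- exact: measurable_funB.
- apply: measurable_funM => //; apply: measurable_sum => i.
  exact: mxmeasurable_cf_E.
Qed.

Lemma measurable_cf_VF : measurable_fun setT (fun x : par => cf_VF M G x j).
Proof.
have mg1 : measurable_fun setT (fun x : par => 1 - @gam R C n x.2 c).
  exact: measurable_funB.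
apply: measurable_funD; first apply: measurable_funD.
- apply: measurable_funM; first exact: measurable_funX.
  exact: mxmeasurable_cf_V.
- apply: measurable_funM; last by apply: measurable_sum => i; exact: mxmeasurable_cf_V.
  apply: measurable_funM => //; apply: measurable_funM => //.
  exact: measurable_funM.
- apply: measurable_funM.
    by apply: measurable_funM => //; exact: measurable_funX.
  by apply: measurable_sum => i; apply: measurable_sum => i'; exact: mxmeasurable_cf_V.
Qed.

Lemma measurable_cf_sqr_error t : measurable_fun setT (cf_sqr_error t).
Proof.
apply: measurable_funD; first exact: measurable_cf_VF.
apply: measurable_funX; apply: measurable_funB => //; exact: measurable_cf_EF.
Qed.

Let sqr_error_lik t (x : par) := t ^+ 2 * marg_lik M U x + (- 2 * t * I1 x + I2 x).

Let mbounded_sqr_error_lik t : mbounded (sqr_error_lik t).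
Proof. exact: mboundedD (mboundedZ _ bI0) (mboundedD (mboundedZ _ bI1) bI2). Qed.

(** The prior charges only 0 < rho <= 1, so integrability and the value of the integral transfer
    from the bounded function [sqr_error_lik] to the closed forms. *)
Let cf_sqr_error_ae t : ae_eq prior setT
  (fun x => (cf_sqr_error t x * marg_lik M U x)%:E) (EFin \o sqr_error_lik t).
Proof.
apply: filterS hrho => x x01 _ /=.
by rewrite cf_sqr_errorE// cond_exp_sqr_error divfK// gt_eqF// marg_lik_gt0.
Qed.

Let m_cf_lik t : measurable_fun setT (fun x => (cf_sqr_error t x * marg_lik M U x)%:E).
Proof.
apply/measurable_EFinP/measurable_funM; first exact: measurable_cf_sqr_error.
by have [] := bI0.
Qed.

Lemma post_integrable_cf_sqr_error t : post_integrable M U prior (cf_sqr_error t).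
Proof.
have /integrableP[mi iS] := mbounded_integrable prior1 (mbounded_sqr_error_lik t).
apply/integrableP; split; first exact: m_cf_lik.
rewrite (@ae_eq_integral _ _ _ prior setT (abse \o (EFin \o sqr_error_lik t)))//.
- exact: measurableT_comp.
- exact: measurableT_comp.
- by apply: filterS (cf_sqr_error_ae t) => x /(_ Logic.I) /= [h] _; rewrite h.
Qed.

Lemma post_exp_cf_sqr_error t :
  post_exp M U prior (cf_sqr_error t) = CPMSE M U prior t j.
Proof.
rewrite /CPMSE /post_exp; congr (_ / _).
rewrite [RHS](eq_Rintegral _ (g := sqr_error_lik t)); last first.
  by move=> x _; rewrite cond_exp_sqr_error divfK// gt_eqF// marg_lik_gt0.
rewrite /Rintegral; congr fine; apply: ae_eq_integral => //.
by apply/measurable_EFinP; have [] := mbounded_sqr_error_lik t.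
Qed.

End FHSCPosterior.

(** * The CPMSE of the benchmarked estimator and its MCMC approximation *)

Theorem proposition3p2
  (R : realType) (C : nat) (n p q : 'I_C -> nat)
  (M : fhsc_data R n p q)
  (hD : forall (c : 'I_C) (j : 'I_(n c)), 0 < direct_var M c ord0 j)
  (d : measure_display) (Phi : measurableType d)
  (G : Phi -> forall c : 'I_C, 'M[R]_(q c))
  (mG : forall (c : 'I_C) (i j : 'I_(q c)), measurable_fun setT (fun f => G f c i j))
  (hG : forall (f : Phi) (c : 'I_C),
      design_Z M c *m G f c *m (design_Z M c)^T \in unitmx)
  (U : R.-pker Phi ~> (\sum_(c < C) q c).-tuple R)
  (hU : random_effects_law G U)
  (prior : probability (((\sum_(c < C) p c).-tuple R * Phi) * R)%type R)
  (hrho : {ae prior, forall x, 0 < x.2 <= 1})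
  (k : nat) (W : 'M[R]_(k, \sum_(c < C) n c)) (b : 'cV[R]_k)
  (hW : row_free W)
  (dS : measure_display) (S : measurableType dS) (P : probability S R)
  (delta_ : nat -> {mfun S >-> (\sum_(c < C) p c).-tuple R})
  (phi_ : nat -> {mfun S >-> Phi})
  (rho_ : nat -> {mfun S >-> R})
  (hmcmc : mcmc_ergodic M U prior P delta_ phi_ rho_)
  (c : 'I_C) (j : 'I_(n c)) :
  let th := theta_hat M U prior j in
  let thB := thetaB_hat M U prior W b j in
  [/\ CPMSE M U prior thB j =
        post_exp M U prior (fun x =>
          cond_exp M U x (fun u => (thB - thetaF M x u c j ord0) ^+ 2)),
      CPMSE M U prior thB j = (thB - th) ^+ 2 + CPMSE M U prior th j,
      (forall x : ((\sum_(c < C) p c).-tuple R * Phi) * R, 0 < x.2 <= 1 ->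
        cond_exp M U x (fun u => thetaF M x u c j ord0) = cf_EF M G x j /\
        cond_var M U x (fun u => thetaF M x u c j ord0) = cf_VF M G x j) &
      forall T : nat, {ae P, forall s,
        (fun L : nat =>
           (thB - th) ^+ 2
           + (L - T)%:R^-1 *
             \sum_(T.+1 <= l < L.+1) cf_VF M G (draw delta_ phi_ rho_ l s) j
           + (L - T)%:R^-1 *
             \sum_(T.+1 <= l < L.+1)
               (cf_EF M G (draw delta_ phi_ rho_ l s) j - th) ^+ 2)
        @ \oo --> CPMSE M U prior thB j}].
Proof.
move=> th thB; split.
- by [].
- exact: CPMSE_decomposition.
- by move=> x x01; exact: conditional_moments.
- move=> T.
  have mh := measurable_cf_sqr_error M mG j th.
  have ih := post_integrable_cf_sqr_error hD mG hG hU hrho j th.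
  have eh := post_exp_cf_sqr_error hD mG hG hU hrho j th.
  (* The ergodic average is that of V + (E - th)^2, whose posterior expectation is the CPMSE of
     [th]. *)
  have h := hmcmc _ mh ih.
  rewrite eh in h.
  rewrite (CPMSE_decomposition hD U prior j thB) -/th.
  apply: filterS h => s /cvg_average_drop -/(_ T) cv.
  (* The variance and squared-deviation averages merge into one; the benchmarking term is constant
     in L. *)
  rewrite (_ : (fun L : nat => _) = (fun L : nat => (thB - th) ^+ 2 + (L - T)%:R^-1 *
    \sum_(T.+1 <= l < L.+1) (cf_VF M G (draw delta_ phi_ rho_ l s) j +
       (cf_EF M G (draw delta_ phi_ rho_ l s) j - th) ^+ 2))).
    by apply: cvgD; [exact: cvg_cst|exact: cv].
  by apply/funext => L; rewrite -addrA -mulrDr -big_split.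
Qed.
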